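(* Let $\rho\in\mathbb{C}$ with $|\rho|=1$ and $\rho\neq -1$. Then the sequence $$\left\{ \left(\frac{1+\rho}{2}\right)^{l_1(n)} 0^{\,l_2(n)} \left(\frac{1-\rho}{2}\right)^{l_3(n)} e^{2\pi i n x} : n\in\mathbb{N}_0 \right\}$$ is a Parseval frame in $L^2(\mu_4)$.
   Context: $\mathbb{N}_0=\{0,1,2,\dots\}$. The Cantor-4 set is $C_4=\{x\in[0,1]: x=\sum_{k=1}^\infty a_k 4^{-k},\ a_k\in\{0,2\}\}$. The measure $\mu_4$ is the uniform measure on $C_4$, i.e. the unique Borel probability measure on $\mathbb{R}$ with $\int f\,d\mu_4=\frac12\left(\int f(\frac{x}{4})\,d\mu_4(x)+\int f(\frac{x+2}{4})\,d\mu_4(x)\right)$ for all $f\in C(\mathbb{R})$; it is supported on $C_4$. $L^2(\mu_4)$ is the complex Hilbert space of square-integrable functions. For $k=1,2,3$ and $n\in\mathbb{N}_0$, $l_k(n)$ is the number of digits equal to $k$ in the base $4$ expansion of $n$ (so $l_k(0)=0$). The convention $0^0=1$ is used. A sequence $\{x_n\}_{n\in I}$ in a Hilbert space $H$ is a Parseval frame if $\sum_{n\in I}|\langle v,x_n\rangle|^2=\|v\|^2$ for all $v\in H$. *)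

(* Defs.v *)
From mathcomp Require Import all_boot all_order all_algebra.
From mathcomp Require Import all_classical all_reals all_analysis.
From mathcomp Require Import complex.
Import Order.TTheory GRing.Theory Num.Theory.
Import numFieldNormedType.Exports.

Set Implicit Arguments.
Unset Strict Implicit.
Unset Printing Implicit Defensive.

Local Open Scope classical_set_scope.
Local Open Scope ring_scope.
Local Open Scope complex_scope.

(* Square-integrable functions are handled through representatives: neither
   [L2ip] nor [Lnorm] changes when a function is modified on a null set, so
   quantifying over [L2fun mu] amounts to quantifying over the Hilbert space
   of almost-everywhere classes.
   [Normc.normc] is the modulus with values in [R]; the ring norm of [R[i]]
   has values in [R[i]]. *)
Definition L2fun d (T : measurableType d) (R : realType)
    (mu : {measure set T -> \bar R}) : set (T -> R[i]) :=
  [set f : T -> R[i] |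
    [/\ measurable_fun setT (fun x => complex.Re (f x)),
        measurable_fun setT (fun x => complex.Im (f x)) &
        finite_norm mu 2%:E (fun x => Normc.normc (f x))]].

Definition cintegral d (T : measurableType d) (R : realType)
    (mu : {measure set T -> \bar R}) (f : T -> R[i]) : R[i] :=
  Rintegral mu setT (fun x => complex.Re (f x)) +i*
  Rintegral mu setT (fun x => complex.Im (f x)).

Definition L2ip d (T : measurableType d) (R : realType)
    (mu : {measure set T -> \bar R}) (f g : T -> R[i]) : R[i] :=
  cintegral mu (fun x => f x * (g x)^*).

Definition parseval_frame d (T : measurableType d) (R : realType)
    (mu : {measure set T -> \bar R}) (x : nat -> T -> R[i]) : Prop :=
  (forall n, L2fun mu (x n)) /\
  (forall v, L2fun mu v ->
     (\sum_(0 <= n <oo) ((Normc.normc (L2ip mu v (x n))) ^+ 2)%:E =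
      'N[mu]_2%:E [EFin \o (fun t => Normc.normc (v t))] ^+ 2)%E).

(* This self-similarity has exactly one solution among the Borel probability
   measures on the line: the uniform measure on the Cantor-4 set.  That measure
   has compact support, so its integrals are finite even for unbounded [f]. *)
Definition is_mu4 (R : realType) (mu : probability (measurableTypeR R) R) :
    Prop :=
  forall f : R -> R, continuous f ->
    (\int[mu]_x (f x)%:E =
     2^-1%:E * (\int[mu]_x (f (x / 4))%:E + \int[mu]_x (f ((x + 2) / 4))%:E))%E.

(* [trunc_log 4 n].+1 is the number of base-4 digits of [n]; for [n = 0] it is
   1, so that 0 is written with the single digit 0. *)
Definition count_digit4 (k n : nat) : nat :=
  \sum_(i < (trunc_log 4 n).+1) (n %/ 4 ^ i %% 4 == k)%N.

Definition expi (R : realType) (t : R) : R[i] := cos t +i* sin t.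

(* Main.v *)
Require Import Defs.
From HB Require Import structures.
From mathcomp Require Import all_boot all_order all_algebra.
From mathcomp Require Import all_classical all_reals all_analysis.
From mathcomp Require Import measurable_realfun complex ring lra zify.
Import Order.TTheory GRing.Theory Num.Theory.
Import numFieldNormedType.Exports.

Set Implicit Arguments.
Unset Strict Implicit.
Unset Printing Implicit Defensive.

Local Open Scope classical_set_scope.
Local Open Scope ring_scope.
Local Open Scope complex_scope.

(** Write [e_t] for the exponential of frequency [t], [c_d] for the weight of
the digit [d], so that [(c_0, c_1, c_2, c_3) = (1, (1 + rho) / 2, 0,
(1 - rho) / 2)], and [x_n] for the [n]-th vector of the sequence.

Reading [n = 4 m + d] digit by digit gives [x_n(y) = c_d e_d(y) x_m(4 y)] on the
Cantor set, because [4 y] differs by an integer from the preimage of [y] under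
the contraction whose image contains [y].  With the self-similarity of the
measure this turns into [<v, x_n> = <T_d v, x_m>] for four explicit operators
[T_0, ..., T_3] ([L2ip_frame_rec]).  As [|c_1|^2 + |c_3|^2 = 1], the
parallelogram law shows that [|T_0 v|^2 + ... + |T_3 v|^2 = |v|^2]
([sum_L2norm2_transfer]); iterating, the sum of [|<v, x_n>|^2] over [n < 4^k] is
the sum of [|<T_w v, 1>|^2] over the words [w] of length [k], hence at most
[|v|^2] ([coefsum_le]).  So the sequence is Bessel, and what remains is that the
defect [Q(v) = |v|^2 - (sum of all |<v, x_n>|^2)] vanishes.

[Q] is a nonnegative quadratic form bounded by [|v|^2], so its null vectors form
a closed subspace, and [Q(v) = Q(T_0 v) + ... + Q(T_3 v)]
([sum_defect_transfer]).  It is killed in three steps.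

- Exponentials.  [T_d e_t] is a multiple of [e_((t - d) / 4)], so [h(t) = Q(e_t)]
  is a convex combination of its values at the points [(t - d) / 4]
  ([defect_character_rec]).  Moreover [h(t)] tends to [0 = h(0)] as [t] tends to
  [0].  From every [t] some child with weight bounded below is closer to the
  origin: [t / 4] when [cos (pi t) >= 0], and otherwise [(t - 1) / 4], whose
  weight is at least [|c_1|^2 / 2].  This is where [rho != -1] enters, and a
  maximum principle yields [h = 0] ([maximum_principle], [defect_character]).
- Half-lines.  If [v] is [e_t] times the indicator of a half-line, then each
  [T_d v] combines two functions of the same kind, one of which is almost
  everywhere [0] or an exponential, as the measure lives on [[0, 1]].  Each use
  of the recursion therefore multiplies a bound on [Q(v)] by a factor less than
  [1], so [Q(v) = 0] ([defect_half]).
- Density.  Half-lines form a pi-system generating the Borel sets, so [Q] kills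
  the indicators of Borel sets, then simple functions, then all of [L^2]
  ([defect_cindic], [defect_eq0]). *)

(** * Squared modulus and unimodular numbers *)

Section SquaredModulus.
Variable R : realType.
Implicit Types (z w : R[i]) (s t : R).

Definition normsq z : R := complex.Re z ^+ 2 + complex.Im z ^+ 2.

Lemma normsq_ge0 z : 0 <= normsq z.
Proof. by rewrite addr_ge0 ?sqr_ge0. Qed.

Lemma sqr_normc_normsq z : Normc.normc z ^+ 2 = normsq z.
Proof. by case: z => a b /=; rewrite sqr_sqrtr // addr_ge0 ?sqr_ge0. Qed.

Lemma normsqM z w : normsq (z * w) = normsq z * normsq w.
Proof. by rewrite -!sqr_normc_normsq Normc.normcM exprMn. Qed.

Lemma normsq_conj z : normsq (z^*)%R = normsq z.
Proof. by case: z => a b; rewrite /normsq /= sqrrN. Qed.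

Lemma normsq_real s : normsq s%:C = s ^+ 2.
Proof. by rewrite /normsq /= expr0n addr0. Qed.

Lemma normsq0 : normsq 0 = 0.
Proof. by rewrite (normsq_real 0) expr0n. Qed.

Lemma normsq1 : normsq 1 = 1.
Proof. by rewrite (normsq_real 1) expr1n. Qed.

Lemma normsq_eq0 z : (normsq z == 0) = (z == 0).
Proof.
case: z => a b; rewrite eq_complex /normsq /=.
by rewrite paddr_eq0 ?sqr_ge0 // !sqrf_eq0.
Qed.

Lemma Re_mulc z w : complex.Re (z * w) =
  complex.Re z * complex.Re w - complex.Im z * complex.Im w.
Proof. by case: z w => [a b] [c d]. Qed.

Lemma Im_mulc z w : complex.Im (z * w) =
  complex.Re z * complex.Im w + complex.Im z * complex.Re w.
Proof. by case: z w => [a b] [c d]. Qed.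

Lemma Re_addc z w : complex.Re (z + w) = complex.Re z + complex.Re w.
Proof. by case: z w => [a b] [c d]. Qed.

Lemma Im_addc z w : complex.Im (z + w) = complex.Im z + complex.Im w.
Proof. by case: z w => [a b] [c d]. Qed.

(** The parallelogram law for the vectors [z] and [w] rescaled so that the cross
terms still cancel.  It bounds a nonnegative quadratic form at [z + w] by [5/4]
times its value at [z] and [5] times its value at [w]; the usual form of the
law has the factor [2] in front of both, too large for a contraction argument in
which the second value is zero. *)
Lemma normsq_parallelogram z w :
  normsq (z + w) + normsq ((2^-1)%:C * z - 2%:C * w) =
  5 / 4 * normsq z + 5 * normsq w.
Proof. by case: z w => [a b] [c d]; rewrite /normsq /=; field. Qed.

Lemma normsq_sum_diff z w :
  normsq (z + w) + normsq (z - w) = 2 * (normsq z + normsq w).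
Proof. by case: z w => [a b] [c d]; rewrite /normsq /=; ring. Qed.

Lemma expi0 : expi (0 : R) = 1.
Proof. by rewrite /expi cos0 sin0. Qed.

Lemma expiD s t : expi (s + t) = expi s * expi t.
Proof.
rewrite /expi sinD cosD; apply/eqP; rewrite eq_complex /=.
by rewrite eqxx /= addrC.
Qed.

Lemma expiN t : expi (- t) = ((expi t)^*)%R.
Proof. by rewrite /expi cosN sinN. Qed.

Lemma normsq_expi t : normsq (expi t) = 1.
Proof. exact: cos2Dsin2. Qed.

Lemma expi_pi : expi pi = -1 :> R[i].
Proof. by rewrite /expi cospi sinpi; apply/eqP; rewrite eq_complex /= oppr0 !eqxx. Qed.

Lemma expi_piMn n : expi (pi * n%:R) = (-1) ^+ n :> R[i].
Proof.
elim: n => [|n IHn]; first by rewrite mulr0 expi0 expr0.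
by rewrite -natr1 mulrDr mulr1 expiD IHn expi_pi exprSr.
Qed.

Lemma normsq_half : normsq (2^-1 : R[i]) = 4^-1.
Proof.
have -> : 2^-1 = (2^-1)%:C :> R[i] by rewrite fmorphV rmorph_nat.
by rewrite normsq_real; field.
Qed.

(** The squared modulus of the average of [1] and the unimodular number by which
[e_s] changes between the two halves of the Cantor set, for [s = t - b]. *)
Lemma normsq_1Dsign_expi b t :
  normsq ((1 + (-1) ^+ b * expi t) / 2) = (1 + (-1) ^+ b * cos t) / 2.
Proof.
rewrite normsqM normsq_half -signr_odd -[in RHS]signr_odd.
have h := cos2Dsin2 t.
by case: (odd b); rewrite !(expr0, expr1) /normsq /expi /=; lra.
Qed.

Lemma sum_normsq_half1Drho (rho : R[i]) : `|rho| = 1 ->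
  normsq ((1 + rho) / 2) + normsq ((1 - rho) / 2) = 1.
Proof.
move=> rho1; have : normsq rho = 1.
  move: rho1; rewrite -sqr_normc_normsq; case: rho => a b /=.
  by move=> [->]; rewrite expr1n.
by rewrite !normsqM normsq_half -mulrDl normsq_sum_diff normsq1 => ->; field.
Qed.

End SquaredModulus.

(** * Square-integrable complex functions *)

Section ComplexMeasurable.
Context d (T : measurableType d) (R : realType).
Implicit Types f g : T -> R[i].

Definition cmeasurable f : Prop :=
  measurable_fun setT (fun x => complex.Re (f x)) /\
  measurable_fun setT (fun x => complex.Im (f x)).

Lemma cmeasurableD f g :
  cmeasurable f -> cmeasurable g -> cmeasurable (fun x => f x + g x).
Proof.
move=> [f1 f2] [g1 g2]; split.
  by under eq_fun do rewrite Re_addc; exact: measurable_funD.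
by under eq_fun do rewrite Im_addc; exact: measurable_funD.
Qed.

Lemma cmeasurableM f g :
  cmeasurable f -> cmeasurable g -> cmeasurable (fun x => f x * g x).
Proof.
move=> [f1 f2] [g1 g2]; split.
  by under eq_fun do rewrite Re_mulc; apply: measurable_funB; exact: measurable_funM.
by under eq_fun do rewrite Im_mulc; apply: measurable_funD; exact: measurable_funM.
Qed.

Lemma cmeasurable_cst c : cmeasurable (fun=> c).
Proof. by split; exact: measurable_cst. Qed.

Lemma cmeasurable_conj f : cmeasurable f -> cmeasurable (fun x => ((f x)^*)%R).
Proof.
move=> [f1 f2]; split.
  rewrite (_ : (fun x => _) = (fun x => complex.Re (f x))) //.
  by apply/funext => x; case: (f x).
rewrite (_ : (fun x => _) = (fun x => - complex.Im (f x))).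
  exact: measurable_funN.
by apply/funext => x; case: (f x).
Qed.

Lemma cmeasurable_real (f : T -> R) :
  measurable_fun setT f -> cmeasurable (fun x => (f x)%:C).
Proof. by move=> mf; split => //; exact: measurable_cst. Qed.

Lemma cmeasurable_expi (f : T -> R) :
  measurable_fun setT f -> cmeasurable (fun x => expi (f x)).
Proof.
move=> mf; split; apply: measurableT_comp => //.
  by apply: continuous_measurable_fun; exact: continuous_cos.
by apply: continuous_measurable_fun; exact: continuous_sin.
Qed.

Lemma measurable_normsq f :
  cmeasurable f -> measurable_fun setT (fun x => normsq (f x)).
Proof. by move=> [f1 f2]; apply: measurable_funD; exact: measurable_funX. Qed.

End ComplexMeasurable.

Section RealIntegrable.
Context d (T : measurableType d) (R : realType) (mu : {measure set T -> \bar R}).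
Implicit Types f g : T -> R.

Definition rintegrable f : Prop := mu.-integrable setT (EFin \o f).

Lemma rintegrableD f g :
  rintegrable f -> rintegrable g -> rintegrable (fun x => f x + g x).
Proof. by move=> f1 g1; apply: (integrableD measurableT f1 g1). Qed.

Lemma rintegrableZ c f : rintegrable f -> rintegrable (fun x => c * f x).
Proof. by move=> f1; apply: (integrableZl measurableT _ f1). Qed.

Lemma rintegrable_le f g : measurable_fun setT f -> rintegrable g ->
  (forall x, `|f x| <= g x) -> rintegrable f.
Proof.
move=> mf ig fg; apply: (le_integrable measurableT _ _ ig).
  exact/measurable_EFinP.
by move=> x _ /=; rewrite lee_fin (le_trans (fg x)) // ler_norm.
Qed.

End RealIntegrable.

Section L2.
Context d (T : measurableType d) (R : realType) (mu : {measure set T -> \bar R}).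
Implicit Types f g u v : T -> R[i].

Lemma Lnorm_normsq f :
  ('N[mu]_2%:E [EFin \o (fun x => Normc.normc (f x))] ^+ 2 =
   \int[mu]_x (normsq (f x))%:E)%E.
Proof.
have -> : (\int[mu]_x (normsq (f x))%:E =
    \int[mu]_x (`|(Normc.normc (f x))%:E| `^ 2))%E.
  apply: eq_integral => x _; rewrite abse_EFin poweR_EFin powR_mulrn //.
  by rewrite real_normK ?num_real // sqr_normc_normsq.
rewrite -poweR_Lnorm //.
have := Lnorm_ge0 mu 2%:E (EFin \o (fun x => Normc.normc (f x))).
case: Lnorm => [r r0|_|//]; last by rewrite poweRyr // /expe /= mulyy.
by rewrite poweR_EFin powR_mulrn // EFin_expe.
Qed.

Lemma finite_norm_normsq f :
  finite_norm mu 2%:E (fun x => Normc.normc (f x)) <->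
  (\int[mu]_x (normsq (f x))%:E < +oo)%E.
Proof.
rewrite /finite_norm -Lnorm_normsq.
have := Lnorm_ge0 mu 2%:E (EFin \o (fun x => Normc.normc (f x))).
case: Lnorm => //= r _; split => _ //; exact: ltry.
Qed.

Lemma normsq_integrable f : L2fun mu f ->
  rintegrable mu (fun x => normsq (f x)).
Proof.
move=> [f1 f2 /finite_norm_normsq f3]; apply/integrableP; split.
  by apply/measurable_EFinP; apply: measurable_normsq; split.
under eq_integral => x _ do rewrite /= ger0_norm ?normsq_ge0 //.
exact: f3.
Qed.

Lemma L2fun_cmeasurable f : L2fun mu f -> cmeasurable f.
Proof. by case. Qed.

Lemma L2fun_dominated f (g : T -> R) : cmeasurable f ->
  rintegrable mu g -> (forall x, normsq (f x) <= g x) ->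
  L2fun mu f.
Proof.
move=> [f1 f2] ig fg; split => //; apply/finite_norm_normsq.
have /integrableP[_] : rintegrable mu (fun x => normsq (f x)).
  apply: (rintegrable_le _ ig); first by apply: measurable_normsq; split.
  by move=> x; rewrite ger0_norm ?normsq_ge0.
by under eq_integral => x _ do rewrite /= ger0_norm ?normsq_ge0 //.
Qed.

Definition L2norm2 f : R := \int[mu]_x normsq (f x).

Lemma L2norm2_ge0 f : 0 <= L2norm2 f.
Proof. by apply: Rintegral_ge0 => x _; exact: normsq_ge0. Qed.

Lemma Lnorm_L2norm2 f : L2fun mu f ->
  ('N[mu]_2%:E [EFin \o (fun x => Normc.normc (f x))] ^+ 2 = (L2norm2 f)%:E)%E.
Proof.
move=> f2; rewrite Lnorm_normsq /L2norm2 /Rintegral fineK //.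
exact: integrable_fin_num (normsq_integrable f2).
Qed.

Lemma L2funZ c f : L2fun mu f -> L2fun mu (fun x => c * f x).
Proof.
move=> f2; apply: (@L2fun_dominated _ (fun x => normsq c * normsq (f x))).
- by apply: cmeasurableM; [exact: cmeasurable_cst|exact: L2fun_cmeasurable].
- exact: (rintegrableZ _ (normsq_integrable f2)).
- by move=> x; rewrite normsqM.
Qed.

Lemma L2funD u v : L2fun mu u -> L2fun mu v -> L2fun mu (fun x => u x + v x).
Proof.
move=> u2 v2.
apply: (@L2fun_dominated _ (fun x => 5 / 4 * normsq (u x) + 5 * normsq (v x))).
- by apply: cmeasurableD; exact: L2fun_cmeasurable.
- by apply: rintegrableD; apply: rintegrableZ; exact: normsq_integrable.
- by move=> x; rewrite -normsq_parallelogram lerDl normsq_ge0.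
Qed.

Lemma L2funB u v : L2fun mu u -> L2fun mu v -> L2fun mu (fun x => u x - v x).
Proof.
move=> u2 /(L2funZ (-1)) v2; have := L2funD u2 v2.
by under eq_fun do rewrite mulN1r.
Qed.

Lemma L2norm2Z c f : L2fun mu f ->
  L2norm2 (fun x => c * f x) = normsq c * L2norm2 f.
Proof.
move=> f2; rewrite /L2norm2; under eq_Rintegral do rewrite normsqM.
by rewrite RintegralZl //; exact: normsq_integrable.
Qed.

Lemma L2norm2_parallelogram u v : L2fun mu u -> L2fun mu v ->
  L2norm2 (fun x => u x + v x) +
    L2norm2 (fun x => (2^-1)%:C * u x - 2%:C * v x) =
  5 / 4 * L2norm2 u + 5 * L2norm2 v.
Proof.
move=> u2 v2; rewrite /L2norm2.
have iu := normsq_integrable u2; have iv := normsq_integrable v2.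
have iD := normsq_integrable (L2funD u2 v2).
have iB := normsq_integrable (L2funB (L2funZ (2^-1)%:C u2) (L2funZ 2%:C v2)).
rewrite -!RintegralZl // -!RintegralD //; try exact: rintegrableZ.
by apply: eq_Rintegral => x _; rewrite normsq_parallelogram.
Qed.

(** Both parts of the product are dominated by the sum of the squared moduli. *)
Lemma L2fun_mul_conj_integrable u v : L2fun mu u -> L2fun mu v ->
  rintegrable mu (fun x => complex.Re (u x * (v x)^*)) /\
  rintegrable mu (fun x => complex.Im (u x * (v x)^*)).
Proof.
move=> u2 v2.
have [m1 m2] : cmeasurable (fun x => u x * (v x)^*).
  by apply: cmeasurableM; [|apply: cmeasurable_conj]; exact: L2fun_cmeasurable.
have h : rintegrable mu (fun x => normsq (u x) + normsq (v x)).
  by apply: rintegrableD; exact: normsq_integrable.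
split.
- apply: (rintegrable_le _ h) => // x.
  case: (u x) (v x) => a b [c e]; rewrite /normsq /= ler_norml.
  have := sqr_ge0 (a - c); have := sqr_ge0 (a + c).
  have := sqr_ge0 (b - e); have := sqr_ge0 (b + e).
  by move=> *; apply/andP; split; nra.
- apply: (rintegrable_le _ h) => // x.
  case: (u x) (v x) => a b [c e]; rewrite /normsq /= ler_norml.
  have := sqr_ge0 (a - e); have := sqr_ge0 (a + e).
  have := sqr_ge0 (b - c); have := sqr_ge0 (b + c).
  by move=> *; apply/andP; split; nra.
Qed.

Definition cintegrable f : Prop :=
  rintegrable mu (fun x => complex.Re (f x)) /\
  rintegrable mu (fun x => complex.Im (f x)).

Lemma cintegralD f g : cintegrable f -> cintegrable g ->
  cintegral mu (fun x => f x + g x) = cintegral mu f + cintegral mu g.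
Proof.
move=> [f1 f2] [g1 g2]; rewrite /cintegral.
apply/eqP; rewrite eq_complex /=; apply/andP; split; apply/eqP.
  by under eq_Rintegral do rewrite Re_addc; rewrite RintegralD.
by under eq_Rintegral do rewrite Im_addc; rewrite RintegralD.
Qed.

Lemma cintegralZ c f : cintegrable f ->
  cintegral mu (fun x => c * f x) = c * cintegral mu f.
Proof.
move=> [f1 f2]; rewrite /cintegral.
case: c => a b; apply/eqP; rewrite eq_complex /=; apply/andP; split; apply/eqP.
  under eq_Rintegral do rewrite Re_mulc /=.
  by rewrite RintegralB ?RintegralZl //; exact: rintegrableZ.
under eq_Rintegral do rewrite Im_mulc /=.
by rewrite RintegralD ?RintegralZl //; exact: rintegrableZ.
Qed.

Lemma L2ipD u v w : L2fun mu u -> L2fun mu v -> L2fun mu w ->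
  L2ip mu (fun x => u x + v x) w = L2ip mu u w + L2ip mu v w.
Proof.
move=> u2 v2 w2; rewrite /L2ip -cintegralD; try exact: L2fun_mul_conj_integrable.
by congr cintegral; apply/funext => x; rewrite mulrDl.
Qed.

Lemma L2ipZ c u w : L2fun mu u -> L2fun mu w ->
  L2ip mu (fun x => c * u x) w = c * L2ip mu u w.
Proof.
move=> u2 w2; rewrite /L2ip -cintegralZ; last exact: L2fun_mul_conj_integrable.
by congr cintegral; apply/funext => x; rewrite mulrA.
Qed.

Lemma L2ip_parallelogram u v w : L2fun mu u -> L2fun mu v -> L2fun mu w ->
  normsq (L2ip mu (fun x => u x + v x) w) +
    normsq (L2ip mu (fun x => (2^-1)%:C * u x - 2%:C * v x) w) =
  5 / 4 * normsq (L2ip mu u w) + 5 * normsq (L2ip mu v w).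
Proof.
move=> u2 v2 w2; rewrite -normsq_parallelogram -L2ipD //; congr (_ + normsq _).
rewrite -mulNr -!L2ipZ // -L2ipD //; try exact: L2funZ.
by congr L2ip; apply/funext => x; rewrite mulNr.
Qed.

End L2.

Section Probability.
Context d (T : measurableType d) (R : realType) (P : probability T R).
Implicit Types f : T -> R[i].

Lemma L2fun_bounded f c : cmeasurable f -> (forall x, normsq (f x) <= c) ->
  L2fun P f.
Proof.
move=> mf fc; apply: (L2fun_dominated mf _ fc).
by apply: finite_measure_integrable_cst.
Qed.

Lemma Rintegral_prob_cst (c : R) : \int[P]_x c = c.
Proof.
rewrite Rintegral_cst // -[RHS]mulr1; congr (_ * _).
by rewrite -[RHS]/(fine 1%E) -(probability_setT P).
Qed.

Lemma rintegrable_cst (c : R) : rintegrable P (fun=> c).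
Proof. exact: finite_measure_integrable_cst. Qed.

Lemma rintegrable_indic (B : set T) : measurable B -> rintegrable P \1_B.
Proof.
move=> mB; apply: (rintegrable_le _ (rintegrable_cst 1)) => [|x].
  exact: measurable_indic.
by rewrite indicE; case: (x \in B); rewrite ?normr1 ?normr0.
Qed.

Lemma Rintegral_indic (B : set T) :
  measurable B -> \int[P]_x \1_B x = fine (P B).
Proof. by move=> mB; rewrite /Rintegral integral_indic // setIT. Qed.

(** Nonnegativity of the variance. *)
Lemma sqr_Rintegral_le (g : T -> R) :
  rintegrable P g -> rintegrable P (fun x => g x ^+ 2) ->
  (\int[P]_x g x) ^+ 2 <= \int[P]_x (g x ^+ 2).
Proof.
move=> g1 g2; set m := \int[P]_x g x.
have : 0 <= \int[P]_x (g x - m) ^+ 2 by apply: Rintegral_ge0 => x _; exact: sqr_ge0.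
have -> : \int[P]_x (g x - m) ^+ 2 =
    \int[P]_x ((g x ^+ 2 + (- 2 * m) * g x) + m ^+ 2).
  by apply: eq_Rintegral => x _; ring.
have i1 : rintegrable P (fun x => (- 2 * m) * g x) by exact: rintegrableZ.
have i2 := rintegrableD g2 i1; have i3 := rintegrable_cst (m ^+ 2).
by rewrite !RintegralD // RintegralZl // Rintegral_prob_cst -/m; nra.
Qed.

Lemma L2fun1 : L2fun P (fun=> 1).
Proof.
by apply: (@L2fun_bounded _ 1) => [|x]; [exact: cmeasurable_cst|rewrite normsq1].
Qed.

Lemma normsq_L2ip1_le f : L2fun P f -> normsq (L2ip P f (fun=> 1)) <= L2norm2 P f.
Proof.
move=> f2; have [mRe mIm] := L2fun_cmeasurable f2.
have [i1 i2] := L2fun_mul_conj_integrable f2 L2fun1.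
have fE x : f x * 1^* = f x.
  by case: (f x) => a b; apply/eqP; rewrite eq_complex /= oppr0 !mulr0 !mulr1 subr0 add0r !eqxx.
have {i1}i1 : rintegrable P (fun x => complex.Re (f x)).
  by move: i1; under eq_fun do rewrite fE.
have {i2}i2 : rintegrable P (fun x => complex.Im (f x)).
  by move: i2; under eq_fun do rewrite fE.
have i3 : rintegrable P (fun x => complex.Re (f x) ^+ 2).
  apply: (rintegrable_le _ (normsq_integrable f2)); first exact: measurable_funX.
  by move=> x; rewrite ger0_norm ?sqr_ge0 // lerDl sqr_ge0.
have i4 : rintegrable P (fun x => complex.Im (f x) ^+ 2).
  apply: (rintegrable_le _ (normsq_integrable f2)); first exact: measurable_funX.
  by move=> x; rewrite ger0_norm ?sqr_ge0 // lerDr sqr_ge0.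
rewrite /L2norm2 RintegralD // /L2ip /cintegral {1}/normsq /=.
under eq_Rintegral do rewrite fE.
under [X in _ + X ^+ 2 <= _]eq_Rintegral do rewrite fE.
by rewrite lerD // sqr_Rintegral_le.
Qed.

End Probability.

(** * Self-similarity and support of the measure *)

Section Ramp.
Variable R : realType.
Implicit Types (a x : R).

(** Continuous functions increasing with [n] to the indicator of the open
half-line below [a]; through them a statement about integrals of continuous
functions reaches the measures of half-lines. *)
Definition ramp a n x : R := Num.min 1 (Num.max 0 (n%:R * (a - x))).

Lemma ramp_ge0 a n x : 0 <= ramp a n x.
Proof. by rewrite /ramp le_min ler01 le_max lexx. Qed.

Lemma continuous_ramp a n : continuous (ramp a n).
Proof.
move=> x; pose h (y : R) : R^o := n%:R * (a - y).
suff ch : {for x, continuous h}.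
  apply: (@continuous_min R R (cst 1) (cst 0 \max h)); first exact: cvg_cst.
  by apply: continuous_max => //; exact: cvg_cst.
have -> : h = (fun y => n%:R * a - n%:R * y) by apply/funext => y; rewrite /h mulrBr.
apply: (@continuousB R R^o R (cst (n%:R * a)) (fun y => n%:R * y)).
  exact: cst_continuous.
exact: mulrl_continuous.
Qed.

Lemma measurable_ramp a n : measurable_fun setT (ramp a n).
Proof. by apply: continuous_measurable_fun; exact: continuous_ramp. Qed.

Lemma nondecreasing_ramp a x : nondecreasing_seq (fun n => ramp a n x).
Proof.
move=> m n mn; rewrite /ramp.
have [xa|xa] := leP a x; last first.
  by rewrite le_min ge_min lexx /= ge_min ge_max !le_max lexx /=
    ler_wpM2r ?ler_nat ?orbT // subr_ge0 ltW.
have h k : Num.max 0 (k%:R * (a - x)) = 0.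
  by apply/max_idPl; rewrite mulr_ge0_le0 // subr_le0.
by rewrite !h.
Qed.

Lemma cvg_ramp a x : ramp a n x @[n --> \oo] --> (\1_`]-oo, a[ x : R).
Proof.
rewrite indicE; apply: cvg_near_cst.
have [xa|xa] := leP a x.
  near=> n; rewrite memNset /=; last by rewrite in_itv /= ltNge xa.
  rewrite /ramp (max_idPl _) ?min_r //.
  by rewrite mulr_ge0_le0 // subr_le0.
near=> n; rewrite mem_set /=; last by rewrite in_itv /= xa.
rewrite /ramp; apply/min_idPl; rewrite le_max; apply/orP; right.
rewrite -ler_pdivrMr ?subr_gt0 // div1r.
near: n; exact: nbhs_infty_ger.
Unshelve. all: by end_near. Qed.

Lemma cvg_int_ramp (m : {measure set (measurableTypeR R) -> \bar R}) a :
  (\int[m]_x (ramp a n x)%:E @[n --> \oo] --> m `]-oo, a[%classic)%E.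
Proof.
have -> : m `]-oo, a[%classic = (\int[m]_x limn (fun n => (ramp a n x)%:E))%E.
  rewrite -(setIT `]-oo, a[%classic) -integral_indic //.
  apply: eq_integral => x _; apply/esym/cvg_lim => //.
  by apply: cvg_EFin; [exact: nearW|exact: cvg_ramp].
apply: cvg_monotone_convergence => //.
- by move=> k; apply/measurable_EFinP; exact: measurable_ramp.
- by move=> k x _; rewrite lee_fin ramp_ge0.
- by move=> x _ k l kl; rewrite lee_fin; exact: nondecreasing_ramp.
Qed.

End Ramp.

Lemma setI_closed_RGenInftyO (R : realType) : setI_closed (@RGenInftyO.G R).
Proof.
move=> _ _ [a ->] [b ->]; exists (Num.min a b).
apply/seteqP; split => x /=; rewrite !in_itv /= lt_min; first by move=> [-> ->].
by move=> /andP[].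
Qed.

Section Invariance.
Variables (R : realType) (mu : probability (measurableTypeR R) R).
Hypothesis hmu : is_mu4 mu.
Local Notation tau0 := (fun x : R => x / 4).
Local Notation tau2 := (fun x : R => (x + 2) / 4).

Lemma measurable_tau0 : measurable_fun setT (tau0 : measurableTypeR R -> measurableTypeR R).
Proof. by apply: measurable_funM => //; exact: measurable_cst. Qed.

Lemma measurable_tau2 : measurable_fun setT (tau2 : measurableTypeR R -> measurableTypeR R).
Proof.
apply: measurable_funM; last exact: measurable_cst.
by apply: measurable_funD => //; exact: measurable_cst.
Qed.

Let X0 : {mfun measurableTypeR R >-> measurableTypeR R} :=
  HB.pack (tau0 : measurableTypeR R -> measurableTypeR R)
    (isMeasurableFun.Build _ _ _ _ _ measurable_tau0).
Let X2 : {mfun measurableTypeR R >-> measurableTypeR R} :=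
  HB.pack (tau2 : measurableTypeR R -> measurableTypeR R)
    (isMeasurableFun.Build _ _ _ _ _ measurable_tau2).
Let nu : {measure set (measurableTypeR R) -> \bar R} :=
  mscale (2^-1)%:nng (measure_add (distribution mu X0) (distribution mu X2)).

Let int_nu (f : R -> \bar R) : measurable_fun setT f -> (forall x, 0 <= f x)%E ->
  (\int[nu]_x f x = 2^-1%:E * (\int[mu]_x f (x / 4)%R + \int[mu]_x f ((x + 2) / 4)%R))%E.
Proof.
move=> mf f0; rewrite ge0_integral_mscale //.
by rewrite ge0_integral_measure_add // !ge0_integral_distribution.
Qed.

(** Both sides integrate the ramps alike, hence agree on the half-lines, which
form a pi-system generating the Borel sets. *)
Let mu_nu (A : set R) : measurable A -> mu A = nu A.
Proof.
apply: (@measure_unique _ R (measurableTypeR R) (@RGenInftyO.G R)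
  (fun n => `]-oo, n%:R[%classic) _ _ _ _ mu nu).
- exact: RGenInftyO.measurableE.
- exact: setI_closed_RGenInftyO.
- by move=> n; exists n%:R.
- rewrite -subTset => x _; exists (Num.truncn x).+1 => //=.
  by rewrite in_itv /= truncnS_gt.
- move=> _ [a ->].
  have hr n : (\int[mu]_x (ramp a n x)%:E = \int[nu]_x (ramp a n x)%:E)%E.
    rewrite hmu; last exact: continuous_ramp.
    rewrite int_nu //.
      by apply/measurable_EFinP; exact: measurable_ramp.
    by move=> x; rewrite lee_fin ramp_ge0.
  apply: (cvg_unique _ (@cvg_int_ramp _ mu a)) => //.
  by move/funext: hr => ->; exact: cvg_int_ramp.
- by move=> n; rewrite (le_lt_trans (probability_le1 _ _)) ?ltry.
Qed.

Lemma ge0_integral_mu4 (f : R -> \bar R) :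
  measurable_fun setT f -> (forall x, 0 <= f x)%E ->
  (\int[mu]_x f x =
   2^-1%:E * (\int[mu]_x f (x / 4)%R + \int[mu]_x f ((x + 2) / 4)%R))%E.
Proof.
move=> mf f0; rewrite -int_nu //.
by apply: eq_measure_integral => A mA _; exact: mu_nu.
Qed.

Lemma mu4_selfsimilar (A : set R) : measurable A ->
  (mu A = 2^-1%:E * (mu (tau0 @^-1` A) + mu (tau2 @^-1` A)))%E.
Proof.
by move=> mA; rewrite mu_nu //; congr (_ * _)%E; exact: measure_addE.
Qed.

Let mu4_eq0 (A : set R) (F : nat -> set R) :
    (forall n, measurable (F n)) -> nonincreasing_seq F ->
    \bigcap_n F n = set0 -> (forall n, mu A <= mu (F n))%E -> mu A = 0%E.
Proof.
move=> mF nF F0 AF; apply/eqP; rewrite eq_le measure_ge0 andbT.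
have : mu \o F @ \oo --> mu (\bigcap_n F n).
  apply: nonincreasing_cvg_mu => //.
  - exact: le_lt_trans (probability_le1 mu (mF 0%N)) (ltry _).
  - by rewrite F0.
rewrite F0 [X in _ --> X](measure0 mu) => h.
by apply: (cvge_to_ge h); apply: nearW => n; exact: AF.
Qed.

(** The measure of [A] is the mean of the measures of its two preimages. *)
Let mu4_le (A B : set R) : measurable A -> measurable B ->
  tau0 @^-1` A `<=` B -> tau2 @^-1` A `<=` B -> (mu A <= mu B)%E.
Proof.
move=> mA mB AB0 AB2; rewrite mu4_selfsimilar //.
have h (f : measurableTypeR R -> measurableTypeR R) : measurable_fun setT f -> f @^-1` A `<=` B ->
    (mu (f @^-1` A) <= mu B)%E.
  move=> mf fAB; apply: le_measure => //; rewrite inE //.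
  by rewrite -[X in measurable X]setTI; exact: mf.
have := leeD (h _ measurable_tau0 AB0) (h _ measurable_tau2 AB2).
have h2 : (0%E <= 2^-1%:E :> \bar R)%E by rewrite lee_fin.
move=> /(lee_wpmul2l h2) /le_trans; apply.
rewrite -(@fineK _ (mu B)) ?fin_num_measure //.
by rewrite -EFinD -EFinM lee_fin; lra.
Qed.

Let pow4_ge (n : nat) : n%:R <= 4 ^+ n :> R.
Proof. by rewrite -natrX ler_nat ltnW // ltn_expl. Qed.

(** For a negative bound the two preimages of the half-line are contained in the
half-line with the bound multiplied by [4].  Iterating, the half-line is pushed
to minus infinity without losing measure. *)
Lemma mu4_itvNy_lt0 (a : R) : a < 0 -> mu `]-oo, a[%classic = 0%E.
Proof.
move=> a0; apply: (@mu4_eq0 _ (fun n => `]-oo, 4 ^+ n * a[%classic)) => //.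
- move=> m n mn; apply/subsetPset => x; rewrite /= !in_itv /= => /lt_le_trans; apply.
  by rewrite ler_nM2r // ler_eXn2l // ltr1n.
- rewrite -subset0 => x /(_ (Num.truncn (x / a)).+1 I); rewrite /= in_itv /=.
  apply/negP; rewrite -leNgt -ler_ndivrMr //.
  by rewrite (le_trans _ (pow4_ge _)) // ltW // truncnS_gt.
- elim=> [|n IHn]; first by rewrite expr0 mul1r.
  apply: (le_trans IHn); apply: mu4_le => // x; rewrite /= !in_itv /= exprS.
    by lra.
  have : 0 < - (4 ^+ n * a) by rewrite -mulrN mulr_gt0 ?oppr_gt0 ?exprn_gt0.
  by lra.
Qed.

(** The argument of [mu4_itvNy_lt0] around the point [1]: since [4 a - 2] exceeds
[1 + 4 (a - 1)], the distance to [1] can be multiplied by [4]. *)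
Lemma mu4_itvy_gt1 (a : R) : 1 < a -> mu `[a, +oo[%classic = 0%E.
Proof.
rewrite -subr_gt0 => a1.
apply: (@mu4_eq0 _ (fun n => `[1 + 4 ^+ n * (a - 1), +oo[%classic)) => //.
- move=> m n mn; apply/subsetPset => x; rewrite /= !in_itv /= !andbT.
  by apply: le_trans; rewrite lerD2l ler_pM2r // ler_eXn2l // ltr1n.
- rewrite -subset0 => x /(_ (Num.truncn (x / (a - 1))).+1 I); rewrite /= in_itv /=.
  apply/negP; rewrite andbT -ltNge.
  apply: (@lt_le_trans _ _ (4 ^+ (Num.truncn (x / (a - 1))).+1 * (a - 1))); last by rewrite lerDr.
  rewrite -ltr_pdivrMr //.
  by rewrite (lt_le_trans _ (pow4_ge _)) // truncnS_gt.
- elim=> [|n IHn]; first by rewrite expr0 mul1r addrC subrK.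
  apply: (le_trans IHn); apply: mu4_le => // x; rewrite /= !in_itv /= !andbT exprS.
    by have : 0 < 4 ^+ n * (a - 1); [rewrite mulr_gt0 ?exprn_gt0|lra].
  by have : 0 < 4 ^+ n * (a - 1); [rewrite mulr_gt0 ?exprn_gt0|lra].
Qed.

End Invariance.

(** * Base 4 digits *)

Section Digits.

Lemma trunc_log4_rec m d : (0 < m)%N -> (d < 4)%N ->
  trunc_log 4 (4 * m + d) = (trunc_log 4 m).+1.
Proof.
move=> m0 d4; apply: trunc_log_eq => //.
have := trunc_logP (isT : 1 < 4)%N m0; have := trunc_log_ltn m (isT : 1 < 4)%N.
by rewrite !expnS; lia.
Qed.

Lemma count_digit4_digit k d : (d < 4)%N -> count_digit4 k d = (d == k).
Proof.
move=> d4; rewrite /count_digit4.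
have -> : trunc_log 4 d = 0%N by move: d d4; do 4?case=> //.
by rewrite big_ord_recl big_ord0 expn0 divn1 modn_small // addn0.
Qed.

(** For [m = 0] the single digit [0] of [m] is no digit of [4 * m + d], whence the
restriction to nonzero [k]. *)
Lemma count_digit4_rec k m d : (0 < k)%N -> (d < 4)%N ->
  count_digit4 k (4 * m + d) = ((d == k) + count_digit4 k m)%N.
Proof.
move=> k0 d4; case: (posnP m) => [->|m0].
  rewrite muln0 add0n !count_digit4_digit //.
  by rewrite [(0 == k)%N]eq_sym -(prednK k0) addn0.
rewrite /count_digit4 trunc_log4_rec // big_ord_recl; congr (_ + _)%N.
  by rewrite expn0 divn1 mulnC modnMDl modn_small.
apply: eq_bigr => i _; congr (nat_of_bool (_ %% _ == _)%N).
by rewrite lift0 expnS divnMA mulnC divnMDl // (divn_small d4) addn0.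
Qed.

Lemma big_nat_mod4 (V : nmodType) (F : nat -> V) N :
  \sum_(n < 4 * N) F n = \sum_(d < 4) \sum_(m < N) F (4 * m + d)%N.
Proof.
elim: N => [|N IHN].
  by rewrite muln0 big_ord0 big1 // => d _; rewrite big_ord0.
under [RHS]eq_bigr do rewrite big_ord_recr /=.
rewrite big_split /= -IHN mulnS addnC !big_ord_recr big_ord0 /= add0r.
by rewrite !addnS !addn0 !big_ord_recr /= !addrA.
Qed.

End Digits.

(** * The transfer operators *)

Section Transfer.
Variables (R : realType) (rho : R[i]).
Implicit Types (x t : R) (v : R -> R[i]).

Definition character t x : R[i] := expi (2 * pi * t * x).

Definition weight n : R[i] :=
  ((1 + rho) / 2) ^+ count_digit4 1 n * 0 ^+ count_digit4 2 n *
  ((1 - rho) / 2) ^+ count_digit4 3 n.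

Definition frame n x : R[i] := weight n * character n%:R x.

Lemma weight0 : weight 0 = 1.
Proof.
by rewrite /weight !count_digit4_digit // !expr0 !mulr1.
Qed.

Lemma weight_rec m d : (d < 4)%N -> weight (4 * m + d) = weight d * weight m.
Proof.
move=> d4; rewrite /weight !count_digit4_rec // !(count_digit4_digit _ d4).
by rewrite !exprD; ring.
Qed.

Lemma character0 x : character 0 x = 1.
Proof. by rewrite /character mulr0 mul0r expi0. Qed.

Lemma characterD s t x : character (s + t) x = character s x * character t x.
Proof. by rewrite /character mulrDr mulrDl expiD. Qed.

Lemma characterN t x : character (- t) x = ((character t x)^*)%R.
Proof. by rewrite /character mulrN mulNr expiN. Qed.

Lemma normsq_character t x : normsq (character t x) = 1.
Proof. exact: normsq_expi. Qed.

Lemma character_tau0 t x : character t (x / 4) = character (t / 4) x.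
Proof. by congr expi; field. Qed.

Lemma character_tau2 t x :
  character t ((x + 2) / 4) = expi (pi * t) * character (t / 4) x.
Proof. by rewrite -expiD; congr expi; field. Qed.

Lemma frame0 : frame 0 = fun=> 1.
Proof. by apply/funext => x; rewrite /frame weight0 character0 mulr1. Qed.

Lemma frame_tau0 m d x : (d < 4)%N ->
  frame (4 * m + d) (x / 4) = weight d * character (d%:R / 4) x * frame m x.
Proof.
move=> d4; rewrite /frame weight_rec // character_tau0.
rewrite (_ : (4 * m + d)%:R / 4 = d%:R / 4 + m%:R) ?characterD; first ring.
by rewrite natrD natrM; field.
Qed.

Lemma frame_tau2 m d x : (d < 4)%N ->
  frame (4 * m + d) ((x + 2) / 4) =
  weight d * (-1) ^+ d * character (d%:R / 4) x * frame m x.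
Proof.
move=> d4; rewrite /frame weight_rec // character_tau2 expi_piMn.
rewrite (_ : (4 * m + d)%:R / 4 = d%:R / 4 + m%:R) ?characterD; last first.
  by rewrite natrD natrM; field.
rewrite exprD exprM (_ : (-1) ^+ 4 = 1) ?expr1n; last by ring.
by ring.
Qed.

(** The adjoint of [f |-> c_d e_d (f o r)], where [r] inverts both contractions
on their images: the mean over the two branches of [v] times the conjugate of
[c_d e_d].  The value of [e_d] at the second branch is [(-1)^d] times its value
at the first, which is where the sign comes from. *)
Definition transfer d v x : R[i] :=
  (weight d)^* * character (- (d%:R / 4)) x *
  ((v (x / 4) + (-1) ^+ d * v ((x + 2) / 4)) / 2).

Lemma transfer_frame m d v x : (d < 4)%N ->
  transfer d v x * (frame m x)^* =
  (2^-1)%:C * (v (x / 4) * (frame (4 * m + d) (x / 4))^* +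
               v ((x + 2) / 4) * (frame (4 * m + d) ((x + 2) / 4))^*).
Proof.
move=> d4; rewrite frame_tau0 // frame_tau2 // /transfer characterN.
move: (weight d) (frame m x) (character _ x) (v _) (v _) => w f e v0 v2.
rewrite !rmorphM rmorphXn rmorphN1 fmorphV rmorph_nat.
by field.
Qed.

Hypothesis rho1 : `|rho| = 1.

Lemma weight_small : [/\ weight 1 = (1 + rho) / 2, weight 2 = 0 &
  weight 3 = (1 - rho) / 2].
Proof.
rewrite /weight !count_digit4_digit //.
by split; rewrite /= !(expr0, expr1) ?mulr1 ?mul1r ?mulr0 ?mul0r.
Qed.

Lemma normsq_weight13 : normsq (weight 1) + normsq (weight 3) = 1.
Proof. by have [-> _ ->] := weight_small; exact: sum_normsq_half1Drho. Qed.

(** The digit [0] picks the sum of the two branch values and the digits [1], [3]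
their difference, with total weight [1] each: this is the parallelogram law. *)
Lemma sum_normsq_transfer v x :
  \sum_(d < 4) normsq (transfer d v x) =
  (normsq (v (x / 4)) + normsq (v ((x + 2) / 4))) / 2.
Proof.
have [_ w2 _] := weight_small.
rewrite !big_ord_recr big_ord0 /= /transfer !normsqM !normsq_conj !normsq_character.
rewrite weight0 w2 normsq0 normsq1 normsq_half !exprS !expr0 !(mulr1,mul1r,mulN1r,mulNr,opprK).
have h := normsq_sum_diff (v (x / 4)) (v ((x + 2) / 4)).
have w := normsq_weight13.
move: h w; set a := normsq (_ + _); set b := normsq (_ - _).
set w1 := normsq (weight 1); set w3 := normsq (weight 3) => h w.
have -> : w3 = 1 - w1 by lra.
by lra.
Qed.

End Transfer.

(** * Bessel inequality *)

Section Mu4Integrals.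
Variables (R : realType) (mu : probability (measurableTypeR R) R).
Hypothesis hmu : is_mu4 mu.
Implicit Types (g : R -> R) (f v : R -> R[i]).

Let ge0_Rintegral_mu4 g : (forall x, 0 <= g x) -> rintegrable mu g ->
  [/\ rintegrable mu (fun x : R => g (x / 4)), rintegrable mu (fun x : R => g ((x + 2) / 4)) &
      \int[mu]_x g x = (\int[mu]_x g (x / 4) + \int[mu]_x g ((x + 2) / 4)) / 2].
Proof.
move=> g0 ig; have mg : measurable_fun setT g.
  by apply/measurable_EFinP; exact: measurable_int ig.
have mg0 : measurable_fun setT (fun x : R => g (x / 4)).
  exact: (measurableT_comp mg (@measurable_tau0 R)).
have mg2 : measurable_fun setT (fun x : R => g ((x + 2) / 4)).
  exact: (measurableT_comp mg (@measurable_tau2 R)).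
have mEg : measurable_fun setT (EFin \o g) by exact/measurable_EFinP.
have E := ge0_integral_mu4 hmu mEg (fun x : R => g0 x : (0 <= (g x)%:E)%E).
have := integrable_fin_num measurableT ig; rewrite E.
set I0 := (\int[mu]_x (EFin \o g) (x / 4)%R)%E.
set I2 := (\int[mu]_x (EFin \o g) ((x + 2) / 4)%R)%E.
have p0 : (0 <= I0)%E by apply: integral_ge0 => x _; rewrite lee_fin.
have p2 : (0 <= I2)%E by apply: integral_ge0 => x _; rewrite lee_fin.
move=> fin.
have foo : (I0 + I2 < +oo)%E.
  rewrite ltey; apply/eqP => e; move: fin.
  by rewrite e gt0_muley // lte_fin.
have f0 : (I0 < +oo)%E by apply: le_lt_trans foo; exact: leeDl.
have f2 : (I2 < +oo)%E by apply: le_lt_trans foo; exact: leeDr.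
have int (h : R -> R) : measurable_fun setT h -> (forall x, 0 <= h x) ->
    (\int[mu]_x (EFin \o h) x < +oo)%E -> rintegrable mu h.
  move=> mh h0 hoo; apply/integrableP; split; first exact/measurable_EFinP.
  by under eq_integral => x _ do rewrite /= ger0_norm //.
split; [exact: int|exact: int|].
have n0 : I0 \is a fin_num by rewrite ge0_fin_numE.
have n2 : I2 \is a fin_num by rewrite ge0_fin_numE.
transitivity (fine (2^-1%:E * (I0 + I2)))%E; first by rewrite /Rintegral E.
have fE (a b : \bar R) : a \is a fin_num -> b \is a fin_num ->
    fine (2^-1%:E * (a + b))%E = (fine a + fine b) / 2.
  by case: a b => [a||] [b||] //= _ _; rewrite mulrC.
exact: fE.
Qed.

Lemma rintegrable_norm g : rintegrable mu g -> rintegrable mu (fun x => `|g x|).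
Proof. by move=> /integrable_norm. Qed.

(** Composition with either contraction preserves integrability because the image
measure is at most twice the measure. *)
Lemma rintegrable_tau g : rintegrable mu g ->
  rintegrable mu (fun x : R => g (x / 4)) /\ rintegrable mu (fun x : R => g ((x + 2) / 4)).
Proof.
move=> ig; have mg : measurable_fun setT g.
  by apply/measurable_EFinP; exact: measurable_int ig.
have [i0 i2 _] := ge0_Rintegral_mu4 (fun x => normr_ge0 (g x)) (rintegrable_norm ig).
split.
  by apply: (rintegrable_le _ i0) => //; exact: (measurableT_comp mg (@measurable_tau0 R)).
by apply: (rintegrable_le _ i2) => //; exact: (measurableT_comp mg (@measurable_tau2 R)).
Qed.

Lemma Rintegral_mu4 g : rintegrable mu g ->
  \int[mu]_x g x = (\int[mu]_x g (x / 4) + \int[mu]_x g ((x + 2) / 4)) / 2.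
Proof.
move=> ig; have iN := rintegrable_norm ig.
have iD := rintegrableD ig iN.
(* [g] is the difference of the nonnegative functions [g + `|g|] and [`|g|]. *)
have pD x : 0 <= g x + `|g x| by have := ler_norm (- g x); rewrite normrN; lra.
have [j0 j2 e] := ge0_Rintegral_mu4 pD iD.
have [k0 k2 e'] := ge0_Rintegral_mu4 (fun x => normr_ge0 (g x)) iN.
have [i0 i2] := rintegrable_tau ig.
by move: e; rewrite !RintegralD // e'; lra.
Qed.

Lemma L2fun_tau v : L2fun mu v ->
  L2fun mu (fun x : R => v (x / 4)) /\ L2fun mu (fun x : R => v ((x + 2) / 4)).
Proof.
move=> v2; have [m1 m2] := L2fun_cmeasurable v2.
have [i0 i2] := rintegrable_tau (normsq_integrable v2); split.
- apply: (L2fun_dominated _ i0) => //.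
  split; [exact: (measurableT_comp m1 (@measurable_tau0 R))|].
  exact: (measurableT_comp m2 (@measurable_tau0 R)).
- apply: (L2fun_dominated _ i2) => //.
  split; [exact: (measurableT_comp m1 (@measurable_tau2 R))|].
  exact: (measurableT_comp m2 (@measurable_tau2 R)).
Qed.

Lemma cintegral_mu4 f : cintegrable mu f ->
  cintegral mu f = (2^-1)%:C * cintegral mu (fun x : R => f (x / 4) + f ((x + 2) / 4)).
Proof.
move=> [f1 f2]; have [i1 i1'] := rintegrable_tau f1.
have [i2 i2'] := rintegrable_tau f2.
rewrite cintegralD // /cintegral (Rintegral_mu4 f1) (Rintegral_mu4 f2).
by apply/eqP; rewrite eq_complex /= !(mul0r, addr0, subr0) ![2^-1 * _]mulrC !eqxx.
Qed.

Section FrameCoefficients.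
Variable rho : R[i].
Hypothesis rho1 : `|rho| = 1.

Lemma L2fun_character t : L2fun mu (character t).
Proof.
apply: (@L2fun_bounded _ _ _ _ _ 1) => [|x]; last by rewrite normsq_character.
apply: (@cmeasurable_expi _ (measurableTypeR R) R (fun x => 2 * pi * t * x)).
exact: mulrl_measurable.
Qed.

Lemma L2funM_bounded f v c : cmeasurable f -> (forall x, normsq (f x) <= c) ->
  L2fun mu v -> L2fun mu (fun x => f x * v x).
Proof.
move=> mf fc v2; apply: (L2fun_dominated _ (rintegrableZ c (normsq_integrable v2))).
  by apply: cmeasurableM => //; exact: L2fun_cmeasurable v2.
by move=> x; rewrite normsqM ler_wpM2r ?normsq_ge0.
Qed.

Lemma L2fun_frame n : L2fun mu (frame rho n).
Proof. exact/L2funZ/L2fun_character. Qed.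

Lemma L2fun_transfer d v : L2fun mu v -> L2fun mu (transfer rho d v).
Proof.
move=> /L2fun_tau[v0 v2].
apply: (@L2funM_bounded _ _ (normsq (weight rho d))).
- apply: cmeasurableM; first exact: cmeasurable_cst.
  exact: (L2fun_cmeasurable (L2fun_character _)).
- by move=> x; rewrite normsqM normsq_conj normsq_character mulr1.
have := L2funZ 2^-1 (L2funD v0 (L2funZ ((-1) ^+ d) v2)).
by under eq_fun do rewrite mulrC.
Qed.

Lemma sum_L2norm2_transfer v : L2fun mu v ->
  \sum_(d < 4) L2norm2 mu (transfer rho d v) = L2norm2 mu v.
Proof.
move=> v2; have iT d := normsq_integrable (L2fun_transfer d v2).
have i01 := rintegrableD (iT 0%N) (iT 1%N); have i012 := rintegrableD i01 (iT 2%N).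
rewrite /L2norm2 !big_ord_recr big_ord0 /= add0r -!RintegralD //; try exact: iT.
rewrite (Rintegral_mu4 (normsq_integrable v2)).
have [i0 i2] := rintegrable_tau (normsq_integrable v2).
rewrite -RintegralD // mulrC -RintegralZl //; last exact: rintegrableD.
apply: eq_Rintegral => x _; rewrite mulrC -(sum_normsq_transfer rho1).
by rewrite !big_ord_recr big_ord0 /= add0r.
Qed.

Lemma L2ip_frame_rec m d v : (d < 4)%N -> L2fun mu v ->
  L2ip mu v (frame rho (4 * m + d)) = L2ip mu (transfer rho d v) (frame rho m).
Proof.
move=> d4 v2; rewrite /L2ip.
have h := L2fun_mul_conj_integrable v2 (L2fun_frame (4 * m + d)).
rewrite (cintegral_mu4 h) -cintegralZ.
  by congr cintegral; apply/funext => x; rewrite -transfer_frame.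
case: h => /rintegrable_tau[i1 i1'] /rintegrable_tau[i2 i2'].
by split; (under eq_fun do rewrite ?Re_addc ?Im_addc); exact: rintegrableD.
Qed.

Definition coefsum k v : R := \sum_(n < 4 ^ k) normsq (L2ip mu v (frame rho n)).

Lemma coefsumS k v : L2fun mu v ->
  coefsum k.+1 v = \sum_(d < 4) coefsum k (transfer rho d v).
Proof.
move=> v2; rewrite /coefsum expnS (big_nat_mod4 (fun n => normsq (L2ip mu v (frame rho n)))).
by apply: eq_bigr => d _; apply: eq_bigr => m _; rewrite L2ip_frame_rec.
Qed.

(** After [k] steps of the norm-preserving recursion only the coefficient along
the constant [x_0] is left, and that one is bounded by Cauchy-Schwarz. *)
Lemma coefsum_le k v : L2fun mu v -> coefsum k v <= L2norm2 mu v.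
Proof.
elim: k v => [|k IHk] v v2.
  by rewrite /coefsum expn0 big_ord1 frame0; exact: normsq_L2ip1_le.
rewrite coefsumS // -sum_L2norm2_transfer //.
by apply: ler_sum => d _; apply: IHk; exact: L2fun_transfer.
Qed.

End FrameCoefficients.
End Mu4Integrals.

(** * The defect in the Parseval identity *)

Section Defect.
Variables (R : realType) (mu : probability (measurableTypeR R) R).
Hypothesis hmu : is_mu4 mu.
Variable rho : R[i].
Hypothesis rho1 : `|rho| = 1.
Implicit Types (u v f : R -> R[i]) (s t : R).

Local Notation L2 := (L2fun mu).
Local Notation coefs := (coefsum mu rho).
Local Notation T := (transfer rho).

(** The sums are cut at powers of [4] because the recursion on digits relates
exactly these. *)
Definition partial_defect k v : R := L2norm2 mu v - coefs k v.

Definition defect v : R := limn (fun k => partial_defect k v).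

Lemma nondecreasing_coefsum v : nondecreasing_seq (fun k => coefs k v).
Proof.
apply/nondecreasing_seqP => k; rewrite /coefsum.
rewrite -!(big_mkord predT (fun n => normsq (L2ip mu v (frame rho n)))).
rewrite [leRHS](@big_cat_nat _ _ _ (4 ^ k)) //= ?leq_exp2l //.
by rewrite lerDl sumr_ge0 // => n _; exact: normsq_ge0.
Qed.

Lemma cvg_defect v : L2 v -> partial_defect k v @[k --> \oo] --> defect v.
Proof.
move=> v2; apply: nonincreasing_is_cvgn.
  by move=> m n mn; rewrite lerD2l lerN2 nondecreasing_coefsum.
by exists 0 => _ [k _ <-]; rewrite subr_ge0 coefsum_le.
Qed.

Lemma defect_ge0 v : L2 v -> 0 <= defect v.
Proof.
move=> v2; apply: (cvgr_to_ge (cvg_defect v2)).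
by apply: nearW => k; rewrite subr_ge0 coefsum_le.
Qed.

Lemma defect_le_partial v k : L2 v -> defect v <= partial_defect k v.
Proof.
move=> v2; apply: (cvgr_to_le (cvg_defect v2)); near=> n.
by rewrite lerD2l lerN2 nondecreasing_coefsum //; near: n; exact: nbhs_infty_ge.
Unshelve. all: by end_near. Qed.

Lemma defect_le v : L2 v -> defect v <= L2norm2 mu v.
Proof.
move=> /(defect_le_partial 0)/le_trans; apply.
by rewrite gerBl sumr_ge0 // => n _; exact: normsq_ge0.
Qed.

Lemma defectZ c v : L2 v -> defect (fun x => c * v x) = normsq c * defect v.
Proof.
move=> v2; apply: (cvg_unique _ (cvg_defect (L2funZ c v2))) => //.
have -> : (fun k => partial_defect k (fun x => c * v x)) =
    (fun k => normsq c * partial_defect k v).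
  apply/funext => k; rewrite /partial_defect L2norm2Z // mulrBr; congr (_ - _).
  rewrite /coefsum mulr_sumr; apply: eq_bigr => n _.
  by rewrite L2ipZ ?normsqM //; exact: L2fun_frame.
by apply: cvgMl_tmp; exact: cvg_defect.
Qed.

Lemma coefsum_parallelogram k u v : L2 u -> L2 v ->
  coefs k (fun x => u x + v x) +
    coefs k (fun x => (2^-1)%:C * u x - 2%:C * v x) =
  5 / 4 * coefs k u + 5 * coefs k v.
Proof.
move=> u2 v2; rewrite /coefsum !mulr_sumr -!big_split /=.
apply: eq_bigr => n _; apply: L2ip_parallelogram => //.
exact: L2fun_frame.
Qed.

(** The defect is a limit of quadratic forms, and the nonnegative term in
[normsq_parallelogram] is dropped. *)
Lemma defectD_le u v : L2 u -> L2 v ->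
  defect (fun x => u x + v x) <= 5 / 4 * defect u + 5 * defect v.
Proof.
move=> u2 v2; have D2 := L2funD u2 v2.
have B2 := L2funB (L2funZ (2^-1)%:C u2) (L2funZ 2%:C v2).
apply: (ler_cvg_to (cvg_defect D2)).
  by apply: cvgD; apply: cvgMl_tmp; exact: cvg_defect.
pose w x := u x + v x; pose z x := (2^-1)%:C * u x - 2%:C * v x.
apply: nearW => k; rewrite -/w /partial_defect.
have hz : coefs k z <= L2norm2 mu z := coefsum_le hmu rho1 k B2.
have eL : L2norm2 mu w + L2norm2 mu z = 5 / 4 * L2norm2 mu u + 5 * L2norm2 mu v :=
  L2norm2_parallelogram u2 v2.
have eC : coefs k w + coefs k z = 5 / 4 * coefs k u + 5 * coefs k v :=
  coefsum_parallelogram k u2 v2.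
by rewrite !fctE; lra.
Qed.

Lemma sum_defect_transfer v : L2 v -> \sum_(d < 4) defect (T d v) = defect v.
Proof.
move=> v2; have c d := cvg_defect (L2fun_transfer hmu rho d v2).
have h : \sum_(d < 4) partial_defect k (T d v) @[k --> \oo] -->
    \sum_(d < 4) defect (T d v).
  under eq_fun do rewrite !big_ord_recr big_ord0 /= add0r.
  by rewrite !big_ord_recr big_ord0 /= add0r; do ?apply: cvgD; exact: c.
apply: (cvg_unique _ h) => //.
have -> : (fun k => \sum_(d < 4) partial_defect k (T d v)) =
    (fun k => partial_defect k.+1 v).
  apply/funext => k; rewrite /partial_defect sumrB.
  by rewrite (sum_L2norm2_transfer hmu rho1 v2) (coefsumS hmu rho k v2).
by have := cvg_defect v2; rewrite -cvg_shiftS.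
Qed.

(** Multiplication by an exponential survives the transfer, with its frequency
moved to [(t - d) / 4]. *)
Lemma transfer_character d t f x :
  T d (fun y => character t y * f y) x =
  ((weight rho d)^*)%R * (character ((t - d%:R) / 4) x *
    ((f (x / 4) + (-1) ^+ d * expi (pi * t) * f ((x + 2) / 4)) / 2)).
Proof.
rewrite /transfer mulrBl characterD character_tau0 character_tau2.
by ring.
Qed.

Definition branch_weight d t : R :=
  normsq (weight rho d) * ((1 + (-1) ^+ d * cos (pi * t)) / 2).

Lemma defect_character_rec t :
  defect (character t) =
  \sum_(d < 4) branch_weight d t * defect (character ((t - d%:R) / 4)).
Proof.
rewrite -sum_defect_transfer; last exact: L2fun_character.
apply: eq_bigr => d _; rewrite /branch_weight -normsq_1Dsign_expi.
rewrite -(normsq_conj (weight rho d)) -normsqM -defectZ; last exact: L2fun_character.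
congr defect; apply/funext => x.
have -> : character t = (fun y => character t y * 1) by apply/funext => y; rewrite mulr1.
by rewrite transfer_character; ring.
Qed.

Lemma branch_weight_ge0 d t : 0 <= branch_weight d t.
Proof. by rewrite /branch_weight -normsq_1Dsign_expi -normsqM normsq_ge0. Qed.

Lemma sum_branch_weight t : \sum_(d < 4) branch_weight d t = 1.
Proof.
have [_ w2 _] := weight_small rho; have w13 := normsq_weight13 rho1.
rewrite !big_ord_recr big_ord0 /= /branch_weight weight0 w2 normsq0 normsq1.
rewrite !exprS expr0; have -> : normsq (weight rho 3) = 1 - normsq (weight rho 1) by lra.
by field.
Qed.

End Defect.

(** * Exponentials have no defect *)

(** Let [M] be the supremum of [h] over a symmetric interval stable under the maps
[t |-> (t - d) / 4].  The gap [M - h] satisfies the same averaging identity and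
is nonnegative, so one contracting step costs at most a factor [kappa].  A fixed
number of steps leads into the neighbourhood of [0] where [h <= M / 2], which
keeps [h] uniformly below [M] unless [M = 0]. *)
Lemma maximum_principle (R : realType) (h : R -> R) (w : 'I_4 -> R -> R)
    (kappa : R) :
  (forall t, 0 <= h t <= 1) ->
  (forall e, 0 < e -> exists2 delta, 0 < delta &
     forall t, `|t| <= delta -> h t <= e) ->
  (forall d t, 0 <= w d t) -> (forall t, \sum_(d < 4) w d t = 1) ->
  (forall t, h t = \sum_(d < 4) w d t * h ((t - d%:R) / 4)) ->
  0 < kappa ->
  (forall t, exists d : 'I_4,
     `|(t - d%:R) / 4| <= 3 / 4 * `|t| /\ kappa <= w d t) ->
  forall t, h t = 0.
Proof.
move=> hb hsmall w0 w1 hrec kappa_gt0 hkappa t0.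
have [L L1 t0L] : exists2 L : R, 1 <= L & `|t0| <= L.
  by exists (Num.max 1 `|t0|); rewrite le_max lexx ?orbT.
pose S := [set h t | t in [set t | `|t| <= L]].
have h0 t : 0 <= h t by case/andP: (hb t).
have h1 t : h t <= 1 by case/andP: (hb t).
have St0 : S (h t0) by exists t0.
have supS : has_sup S.
  by split; [exists (h t0)|exists 1 => _ [t _ <-]].
have [M hM leM] : exists2 M : R, (forall t, `|t| <= L -> h t <= M) &
    forall c, (forall t, `|t| <= L -> h t <= c) -> M <= c.
  exists (sup S) => [t tL|c hc]; first by apply: (sup_upper_bound supS); exists t.
  by apply: ge_sup => [|_ [t tL <-]]; [exists (h t0)|exact: hc].
suff M0 : M <= 0 by apply/eqP; rewrite eq_le h0 andbT (le_trans (hM _ t0L)).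
rewrite leNgt; apply/negP => M0.
have child t (d : 'I_4) : `|t| <= L -> `|(t - d%:R) / 4| <= L.
  move=> tL; rewrite normrM [`|4^-1|]ger0_norm //.
  have d3 : d%:R <= 3 :> R by rewrite ler_nat -ltnS.
  have := ler_normB t d%:R; rewrite normr_nat.
  by lra.
have [q [qE q0 q1]] : exists q : R, [/\ q = 3 / 4, 0 <= q & q < 1].
  by exists (3 / 4); split => //; lra.
have step t : `|t| <= L -> exists2 t', `|t'| <= q * `|t| &
    kappa * (M - h t') <= M - h t.
  move=> tL; have [d [d1 d2]] := hkappa t.
  exists ((t - d%:R) / 4); first by rewrite qE.
  have -> : M - h t = \sum_(j < 4) w j t *
      (M - h ((t - j%:R) / 4)).
    under eq_bigr do rewrite mulrBr.
    by rewrite sumrB -mulr_suml w1 mul1r -hrec.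
  rewrite (bigD1 d) //= -[leLHS]addr0; apply: lerD.
    by apply: ler_wpM2r => //; rewrite subr_ge0 hM // child.
  by apply: sumr_ge0 => j _; rewrite mulr_ge0 ?w0 ?subr_ge0 ?hM // child.
have L0 : 0 <= L by lra.
have qk1 k : q ^+ k <= 1 :> R by rewrite exprn_ile1 // ltW.
(* The orbit of contracting children shrinks geometrically. *)
have iterate k t : `|t| <= L -> exists2 t', `|t'| <= q ^+ k * L &
    kappa ^+ k * (M - h t') <= M - h t.
  elim: k t => [|k IHk] t tL; first by exists t; rewrite ?expr0 ?mul1r.
  have [t' t'1 t'2] := IHk t tL.
  have t'L : `|t'| <= L.
    exact: le_trans t'1 (ler_piMl L0 (qk1 k)).
  have [s s1 s2] := step t' t'L; exists s.
    by rewrite (le_trans s1) // exprS -mulrA ler_wpM2l.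
  by rewrite (le_trans _ t'2) // exprSr -mulrA ler_wpM2l // exprn_ge0 // ltW.
have [delta delta0 hdelta] := hsmall _ (divr_gt0 M0 (ltr0Sn _ 1)).
have [k hk] : exists k, q ^+ k * L <= delta.
  have /cvg_expr : `|q| < 1 by rewrite ger0_norm.
  move=> /cvgrPdist_le /(_ (delta / L)) [|k _ /(_ k (leqnn k))].
    by rewrite divr_gt0 //; lra.
  rewrite sub0r normrN ger0_norm ?exprn_ge0 // => qk; exists k.
  by rewrite -ler_pdivlMr //; lra.
have kk : 0 < kappa ^+ k by rewrite exprn_gt0.
have : M <= M - kappa ^+ k * (M / 2).
  apply: leM => t tL; have [t' t'1 t'2] := iterate k t tL.
  have ht' := hdelta t' (le_trans t'1 hk).
  have : kappa ^+ k * (M / 2) <= kappa ^+ k * (M - h t').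
    by rewrite ler_pM2l //; lra.
  by lra.
by rewrite lerDl oppr_ge0 leNgt mulr_gt0 // divr_gt0.
Qed.

Section DefectCharacter.
Variables (R : realType) (mu : probability (measurableTypeR R) R).
Hypothesis hmu : is_mu4 mu.
Variable rho : R[i].
Hypothesis rho1 : `|rho| = 1.
Hypothesis rhoN1 : rho != -1.
Implicit Types (u v f : R -> R[i]) (s t : R).

Local Notation L2 := (L2fun mu).
Local Notation defect := (defect mu rho).

(** Null set off which the integration variable is bounded by [2]. *)
Let outside : set (measurableTypeR R) := `]-oo, (-1)[%classic `|` `[2, +oo[%classic.

Let measurable_outside : measurable outside.
Proof. exact: measurableU. Qed.

Let outside0 : mu outside = 0%E.
Proof.
rewrite null_set_setU //.
  by apply: (mu4_itvNy_lt0 hmu); rewrite ltrN10.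
by apply: (mu4_itvy_gt1 hmu); rewrite ltr1n.
Qed.

Lemma L2norm2_character t : L2norm2 mu (character t) = 1.
Proof.
rewrite /L2norm2; under eq_Rintegral do rewrite normsq_character.
exact: Rintegral_prob_cst.
Qed.

(** The coefficient along [x_0 = 1] alone nearly exhausts the norm of a slowly
varying exponential. *)
Lemma defect_character_small (e : R) : 0 < e ->
  exists2 delta, 0 < delta & forall t, `|t| <= delta -> defect (character t) <= e.
Proof.
move=> e0; pose e' := Num.min 1 (e / 2).
have e'0 : 0 < e' by rewrite lt_min ltr01 divr_gt0.
have [eta /= eta0 heta] : exists2 eta : R, 0 < eta & forall y, `|y| < eta -> 1 - e' <= cos y.
  have /cvgrPdist_le/(_ e' e'0) : cos x @[x --> (0 : R)] --> (1 : R).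
    by rewrite -cos0; exact: continuous_cos.
  move=> /nbhs_ballP[eta eta0 h]; exists eta => // y ye.
  have := h y; rewrite /ball /= sub0r normrN => /(_ ye).
  by rewrite ler_norml => /andP[_]; lra.
have pi0 := pi_gt0 R.
(* Off a null set [|x| <= 2], so the phase is at most [4 pi |t| <= eta / 2]. *)
exists (eta / (8 * pi)) => [|t tle]; first by rewrite divr_gt0 // mulr_gt0.
apply: (le_trans (defect_le_partial hmu rho1 0 (L2fun_character mu t))).
rewrite /partial_defect /coefsum expn0 big_ord1 frame0 L2norm2_character.
set z := L2ip _ _ _.
have [i1 _] := L2fun_mul_conj_integrable (L2fun_character mu t) (L2fun1 mu).
have iB := rintegrable_indic mu measurable_outside.
have B0 : \int[mu]_x \1_outside x = 0 by rewrite Rintegral_indic // outside0.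
have cE : (fun x : R => complex.Re (character t x * 1^*)) = (fun x : R => cos (2 * pi * t * x)).
  by apply/funext => x; rewrite rmorph1 mulr1.
have : 1 - e' <= complex.Re z.
  rewrite /z /L2ip /cintegral /= cE.
  have iL : rintegrable mu (fun x => (1 - e') + (-2) * \1_outside x).
    by apply: rintegrableD; [exact: rintegrable_cst|exact: rintegrableZ].
  have -> : 1 - e' = \int[mu]_x ((1 - e') + (-2) * \1_outside x).
    rewrite RintegralD ?RintegralZl //; last 2 first.
    - exact: rintegrable_cst.
    - exact: rintegrableZ.
    by rewrite B0 mulr0 addr0 Rintegral_prob_cst.
  apply: le_Rintegral => //; first by rewrite -cE.
  move=> x _ /=; rewrite indicE; have [xB|xB] := boolP (x \in outside).
    by rewrite mulr1; have := cos_geN1 (2 * pi * t * x); lra.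
  rewrite mulr0 addr0; apply: heta.
  have x2 : `|x| <= 2.
    move: xB; rewrite notin_setE /outside /= !in_itv /= andbT => /not_orP[/negP + /negP].
    by rewrite -leNgt -ltNge ler_norml => h1 h2; apply/andP; split; lra.
  rewrite !normrM (ger0_norm (ltW pi0)) normr_nat.
  have : 2 * pi * `|t| <= eta / 4.
    have -> : eta / 4 = 2 * pi * (eta / (8 * pi)).
      by move: (@pi R) pi0 => p p0; field; exact: lt0r_neq0.
    by rewrite ler_pM2l // mulr_gt0.
  move=> h; apply: (@le_lt_trans _ _ (eta / 4 * 2)); last by lra.
  by apply: ler_pM => //; rewrite !mulr_ge0 // ltW.
have e'1 : e' <= 1 by rewrite ge_min lexx.
have e'e : e' <= e / 2 by rewrite ge_min lexx orbT.
move=> zle; have : (1 - e') ^+ 2 <= normsq z.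
  rewrite /normsq; apply: (@le_trans _ _ (complex.Re z ^+ 2)); last by rewrite lerDl sqr_ge0.
  by rewrite ler_pXn2r // nnegrE ?subr_ge0 // (le_trans _ zle) // subr_ge0.
by have := sqr_ge0 e'; nra.
Qed.

(** Where [cos (pi t)] is negative, [|t| > 1 / 2], so that [|t - 1| <= 3 |t|]: the
child of digit [1] is then closer to the origin as well.  Its weight is positive
because [rho] differs from [-1]. *)
Let contracting_child : exists2 kappa : R, 0 < kappa &
  forall t, exists d : 'I_4,
    `|(t - d%:R) / 4| <= 3 / 4 * `|t| /\ kappa <= branch_weight rho d t.
Proof.
have w1 : 0 < normsq (weight rho 1).
  have [-> _ _] := weight_small rho.
  rewrite lt_neqAle normsq_ge0 andbT eq_sym normsq_eq0 mulf_eq0 invr_eq0 negb_or.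
  by rewrite addrC addr_eq0 rhoN1 pnatr_eq0.
exists (Num.min 1 (normsq (weight rho 1)) / 2) => [|t].
  by rewrite divr_gt0 // lt_min ltr01.
set kappa := _ / 2.
have k1 : kappa <= 1 / 2 by rewrite ler_pM2r // ge_min lexx.
have k2 : kappa <= normsq (weight rho 1) / 2 by rewrite ler_pM2r // ge_min lexx orbT.
have [c0|c0] := leP 0 (cos (pi * t)).
  exists ord0; rewrite subr0 /branch_weight /= weight0 normsq1 expr0 mul1r mul1r.
  split; last by lra.
  by rewrite normrM [`|4^-1|]ger0_norm // mulrC; apply: ler_wpM2r => //; lra.
exists 1; rewrite /branch_weight /= expr1.
split; last first.
  apply: (le_trans k2); apply: ler_wpM2l; first exact: normsq_ge0.
  by lra.
have t2 : 1 / 2 < `|t|.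
  rewrite ltNge; apply/negP => t2; move: c0; rewrite ltNge => /negP; apply.
  apply: cos_ge0_pihalf; move: t2; rewrite ler_norml => /andP[t1 t2].
  by have := pi_gt0 R; move=> p; apply/andP; split; nra.
rewrite normrM [`|4^-1|]ger0_norm //.
have := ler_normB t 1; rewrite normr1.
by lra.
Qed.

Lemma defect_character t : defect (character t) = 0.
Proof.
have [kappa k0 hk] := contracting_child.
apply: (@maximum_principle _ (fun t => defect (character t))
  (fun d => branch_weight rho d) kappa) => // {}t.
- have t2 := L2fun_character mu t.
  by rewrite defect_ge0 // -(L2norm2_character t) defect_le.
- exact: defect_character_small.
- exact: branch_weight_ge0.
- exact: sum_branch_weight.
- exact: defect_character_rec.
Qed.

End DefectCharacter.

(** * Half-lines have no defect *)

Section HalfLines.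
Variables (R : realType) (mu : probability (measurableTypeR R) R).
Hypothesis hmu : is_mu4 mu.
Variable rho : R[i].
Hypothesis rho1 : `|rho| = 1.
Hypothesis rhoN1 : rho != -1.
Implicit Types (u v f : R -> R[i]) (s t a : R).

Local Notation L2 := (L2fun mu).
Local Notation defect := (defect mu rho).
Local Notation T := (transfer rho).

Lemma L2norm2_null (B : set R) u : L2 u -> measurable B -> mu B = 0%E ->
  (forall x, normsq (u x) <= \1_B x) -> L2norm2 mu u = 0.
Proof.
move=> u2 mB B0 uB; have IB0 : \int[mu]_x \1_B x = 0.
  by rewrite Rintegral_indic // B0.
apply/eqP; rewrite eq_le L2norm2_ge0 andbT -IB0.
apply: le_Rintegral => //; first exact: normsq_integrable.
exact: rintegrable_indic.
Qed.

Let defect_null u : L2 u -> L2norm2 mu u = 0 -> defect u = 0.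
Proof.
move=> u2 u0; apply/eqP; rewrite eq_le defect_ge0 // andbT.
by rewrite -u0 defect_le.
Qed.

Lemma defect0D u v : L2 u -> L2 v -> defect u = 0 -> defect v = 0 ->
  defect (fun x => u x + v x) = 0.
Proof.
move=> u2 v2 u0 v0; apply/eqP; rewrite eq_le defect_ge0 ?andbT //; last exact: L2funD.
by rewrite (le_trans (defectD_le hmu rho1 u2 v2)) // u0 v0 !mulr0 addr0.
Qed.

Lemma defect0Z c u : L2 u -> defect u = 0 -> defect (fun x => c * u x) = 0.
Proof. by move=> u2 u0; rewrite defectZ // u0 mulr0. Qed.

Lemma defect0B u v : L2 u -> L2 v -> defect u = 0 -> defect v = 0 ->
  defect (fun x => u x - v x) = 0.
Proof.
move=> u2 v2 u0 v0.
have := defect0D u2 (L2funZ (-1) v2) u0 (defect0Z (-1) v2 v0).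
by under eq_fun do rewrite mulN1r.
Qed.

(** The null vectors of the defect are closed in norm, since
[Q(v) <= 5/4 Q(u) + 5 |v - u|^2]. *)
Lemma defect0_closed v : L2 v ->
  (forall e : R, 0 < e -> exists u, [/\ L2 u, defect u = 0 &
     L2norm2 mu (fun x => v x - u x) <= e]) ->
  defect v = 0.
Proof.
move=> v2 H; apply/eqP; rewrite eq_le defect_ge0 // andbT.
apply/ler_addgt0Pl => e e0; rewrite addr0.
have [u [u2 u0 uv]] := H (e / 5) (divr_gt0 e0 (ltr0Sn _ 4)).
have B2 := L2funB v2 u2.
have -> : v = (fun x => u x + (v x - u x)) by apply/funext => x; rewrite addrC subrK.
apply: (le_trans (defectD_le hmu rho1 u2 B2)); rewrite u0 mulr0 add0r.
have e5 : e = 5 * (e / 5) by field.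
rewrite e5; apply: ler_wpM2l => //.
exact: le_trans (defect_le hmu rho1 B2) uv.
Qed.

Definition cindic (B : set R) : R -> R[i] := fun x => (\1_B x)%:C.

Lemma normsq_cindic B x : normsq (cindic B x) = \1_B x.
Proof.
rewrite normsq_real indicE; case: (x \in B) => /=; first by rewrite expr1n.
by rewrite expr0n.
Qed.

Lemma L2fun_cindic B : measurable B -> L2 (cindic B).
Proof.
move=> mB; apply: (@L2fun_bounded _ _ _ _ _ 1).
  by apply: cmeasurable_real; exact: measurable_indic.
by move=> x; rewrite normsq_cindic indicE; case: (x \in B).
Qed.

Let half a : set R := `]-oo, a[%classic.
Let step t a : R -> R[i] := fun x => character t x * cindic (half a) x.

Let L2step t a : L2 (step t a).
Proof.
apply: (L2funM_bounded (c := 1)).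
- exact: (L2fun_cmeasurable (L2fun_character mu t)).
- by move=> x; rewrite normsq_character.
- by apply: L2fun_cindic; exact: measurable_itv.
Qed.

Let cindic_tau0 a x : cindic (half a) (x / 4) = cindic (half (4 * a)) x.
Proof.
rewrite /cindic !indicE; congr ((_%:R)%:C); congr nat_of_bool.
by apply/idP/idP; rewrite !inE /half /= !in_itv /=; lra.
Qed.

Let cindic_tau2 a x : cindic (half a) ((x + 2) / 4) = cindic (half (4 * a - 2)) x.
Proof.
rewrite /cindic !indicE; congr ((_%:R)%:C); congr nat_of_bool.
by apply/idP/idP; rewrite !inE /half /= !in_itv /=; lra.
Qed.

Let defect_step_lt0 t a : a < 0 -> defect (step t a) = 0.
Proof.
move=> a0; apply: defect_null => //.
apply: (@L2norm2_null (half a)) => //.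
- exact: measurable_itv.
- exact: (mu4_itvNy_lt0 hmu).
by move=> x; rewrite normsqM normsq_character mul1r normsq_cindic.
Qed.

Let defect_step_gt1 t a : 1 < a -> defect (step t a) = 0.
Proof.
move=> a1; have := defect_character hmu rho1 rhoN1 t.
have c2 := L2fun_character mu t.
have -> : step t a = (fun x => character t x -
    character t x * cindic (`[a, +oo[%classic) x).
  apply/funext => x; rewrite /step /cindic !indicE.
  have -> : (x \in (`[a, +oo[%classic : set R)) = ~~ (x \in half a).
    by apply/idP/idP; rewrite !inE /half /= !in_itv /= ?andbT -?leNgt //;
      rewrite notin_setE /= in_itv /= leNgt => /negP.
  by case: (x \in half a); rewrite /= ?mulr0 ?mulr1 ?subr0 ?subrr.
have m : measurable (`[a, +oo[%classic : set R) by exact: measurable_itv.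
have g2 : L2 (fun x => character t x * cindic `[a, +oo[%classic x).
  apply: (L2funM_bounded (c := 1)); last exact: L2fun_cindic.
    exact: (L2fun_cmeasurable c2).
  by move=> x; rewrite normsq_character.
have gle x : normsq (character t x * cindic `[a, +oo[%classic x) <=
    (\1_(`[a, +oo[%classic : set R) x : R).
  by rewrite normsqM normsq_character mul1r normsq_cindic.
move=> e0; apply: (defect0B c2 g2 e0); apply: (defect_null g2).
exact: (L2norm2_null g2 m (mu4_itvy_gt1 hmu a1) gle).
Qed.

(** The image of [e_t] times the indicator of the half-line below [a] involves the
half-lines below [4 a] and [4 a - 2].  Either [4 a - 2 < 0] and the second misses
the support, or [4 a > 1] and the first contains it; in both cases only one term
has a defect.  The factor [1/4] of the average, the factor [5/4] of [defectD_le]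
and the total squared weight [2] multiply to [5/8]. *)
Let defect_step_le k t a : defect (step t a) <= (5 / 8) ^+ k.
Proof.
elim: k t a => [|k IHk] t a.
  rewrite expr0 -(L2norm2_character mu t) (le_trans (defect_le hmu rho1 (L2step t a))) //.
  apply: le_Rintegral => //.
  - exact: (normsq_integrable (L2step t a)).
  - exact: (normsq_integrable (L2fun_character mu t)).
  move=> x _; rewrite normsqM normsq_character mul1r normsq_cindic indicE.
  by case: (x \in _).
rewrite -(sum_defect_transfer hmu rho1 (L2step t a)).
have dle d : defect (T d (step t a)) <= normsq (weight rho d) * (5 / 16 * (5 / 8) ^+ k).
  pose s := (t - d%:R) / 4; pose eps := (-1) ^+ d * expi (pi * t) : R[i].
  have eps1 : normsq eps = 1.
    rewrite normsqM normsq_expi mulr1 -signr_odd; case: (odd d).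
      by rewrite expr1 /normsq /= oppr0 expr0n addr0 sqrrN expr1n.
    by rewrite expr0 normsq1.
  have -> : T d (step t a) = (fun x => ((weight rho d)^*)%R * (2^-1 *
      (step s (4 * a) x + eps * step s (4 * a - 2) x))).
    apply/funext => x; rewrite transfer_character cindic_tau0 cindic_tau2.
    by rewrite /step -/s -/eps; ring.
  have s2 := L2step s (4 * a); have s2' := L2funZ eps (L2step s (4 * a - 2)).
  rewrite (defectZ hmu rho1); last exact/L2funZ/L2funD.
  rewrite normsq_conj (defectZ hmu rho1) ?normsq_half; last exact: L2funD.
  apply: ler_wpM2l; first exact: normsq_ge0.
  suff : defect (fun x => step s (4 * a) x + eps * step s (4 * a - 2) x) <=
      5 / 4 * (5 / 8) ^+ k.
    move=> h; have := ler_wpM2l (_ : 0 <= 4^-1 :> R) h; rewrite invr_ge0 ler0n => /(_ isT).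
    move=> {}h; apply: (le_trans h); rewrite mulrA le_eqVlt; apply/orP; left; apply/eqP.
    by congr (_ * _); field.
  have k0 : 0 <= 5 / 4 :> R by rewrite divr_ge0.
  (* Any threshold greater than 1 and at most 2 would do. *)
  have [a2|a2] := ltP (4 * a) (3 / 2).
    apply: (le_trans (defectD_le hmu rho1 s2 s2')).
    rewrite (defectZ hmu rho1 eps (L2step s (4 * a - 2))) eps1 mul1r.
    have a2' : 4 * a - 2 < 0 by lra.
    by rewrite (defect_step_lt0 s a2') mulr0 addr0; exact: (ler_wpM2l k0 (IHk _ _)).
  under eq_fun do rewrite addrC.
  apply: (le_trans (defectD_le hmu rho1 s2' s2)).
  rewrite (defectZ hmu rho1 eps (L2step s (4 * a - 2))) eps1 mul1r.
  have a2' : 1 < 4 * a by lra.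
  by rewrite (defect_step_gt1 s a2') mulr0 addr0; exact: (ler_wpM2l k0 (IHk _ _)).
apply: (@le_trans _ _ (\sum_(d < 4) normsq (weight rho d) * (5 / 16 * (5 / 8) ^+ k))).
  by apply: ler_sum => d _; exact: dle.
rewrite -mulr_suml !big_ord_recr big_ord0 /= exprS.
have [_ w2 _] := weight_small rho; have w13 := normsq_weight13 rho1.
rewrite weight0 w2 normsq0 normsq1 (_ : 0 + 1 + _ + 0 + _ = 2); last by lra.
by lra.
Qed.

Lemma defect_half a : defect (cindic (half a)) = 0.
Proof.
have -> : cindic (half a) = step 0 a.
  by apply/funext => x; rewrite /step character0 mul1r.
apply/eqP; rewrite eq_le defect_ge0 // andbT.
have /cvg_expr h : `|5 / 8 : R| < 1 by rewrite ger0_norm; lra.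
apply: (cvgr_to_ge h); apply: nearW => k; exact: defect_step_le.
Qed.

End HalfLines.

(** * Density *)

Lemma maxB_opp (R : realDomainType) (x : R) : x = Num.max x 0 - Num.max (- x) 0.
Proof. by case: (leP x 0); case: (leP (- x) 0); lra. Qed.

Section Density.
Variables (R : realType) (mu : probability (measurableTypeR R) R).
Hypothesis hmu : is_mu4 mu.
Variable rho : R[i].
Hypothesis rho1 : `|rho| = 1.
Hypothesis rhoN1 : rho != -1.
Implicit Types (u v f : R -> R[i]) (s t a : R).

Local Notation L2 := (L2fun mu).
Local Notation defect := (defect mu rho).

Lemma defect0_lim (u : nat -> R -> R[i]) v : L2 v -> (forall n, L2 (u n)) ->
  (forall n, defect (u n) = 0) ->
  L2norm2 mu (fun x => v x - u n x) @[n --> \oo] --> (0 : R) -> defect v = 0.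
Proof.
move=> v2 u2 u0 /cvgrPdist_le uv; apply: (defect0_closed hmu rho1 v2) => e e0.
have [N _ /(_ N (leqnn N))] := uv e e0.
rewrite sub0r normrN ger0_norm ?L2norm2_ge0 // => h.
by exists (u N); split; [exact: u2|exact: u0|exact: h].
Qed.

Let defect_bigcup (F : nat -> set R) : (forall n, measurable (F n)) ->
  nondecreasing_seq F -> (forall n, defect (cindic (F n)) = 0) ->
  defect (cindic (\bigcup_n F n)) = 0.
Proof.
move=> mF ndF F0; set B := \bigcup_n F n.
have mB : measurable B by exact: bigcupT_measurable.
apply: (@defect0_lim (fun n => cindic (F n))).
- exact: L2fun_cindic.
- by move=> n; exact: L2fun_cindic.
- exact: F0.
have -> : (fun n => L2norm2 mu (fun x => cindic B x - cindic (F n) x)) =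
    (fun n => fine (mu B) - fine (mu (F n))).
  apply/funext => n; rewrite -(Rintegral_indic mu mB) -(Rintegral_indic mu (mF n)).
  rewrite -RintegralB //; [|exact: (rintegrable_indic mu mB)|exact: (rintegrable_indic mu (mF n))].
  apply: eq_Rintegral => x _; rewrite /cindic -rmorphB normsq_real !indicE.
  have [xF|xF] := boolP (x \in F n).
    have -> : x \in B by rewrite inE; exists n => //; exact: set_mem.
    by rewrite subrr expr0n.
  by case: (x \in B); rewrite subr0 ?expr1n ?expr0n.
rewrite -(subrr (fine (mu B))); apply: cvgB; first exact: cvg_cst.
apply: fine_cvg; rewrite fineK ?fin_num_measure //.
exact: nondecreasing_cvg_mu.
Qed.

(** The sets whose indicator has no defect form a lambda-system, by linearity and
by monotone limits in norm. *)
Lemma defect_cindic (B : set R) : measurable B ->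
  defect (cindic B) = 0.
Proof.
move=> mB; suff [] : [set A : set R |
  measurable A /\ defect (cindic A) = 0] B by [].
apply: (@lambda_system_subset _ (@RGenInftyO.G R) _ setT) => //.
- exact: setI_closed_RGenInftyO.
- split.
  + by [].
  + split; first exact: measurableT.
    have -> : cindic [set: R] = character 0.
      by apply/funext => x; rewrite character0 /cindic indicE in_setT.
    exact: (defect_character hmu rho1 rhoN1).
  + move=> A C CA [mA A0] [mC C0]; split; first exact: measurableD.
    have -> : cindic (A `\` C) = (fun x => cindic A x - cindic C x).
      apply/funext => x; rewrite /cindic -rmorphB !indicE in_setD; congr (_%:C).
      have [xC|xC] := boolP (x \in C); last by rewrite subr0 andbT.
      have -> : x \in A by rewrite inE; apply: CA; exact: set_mem.
      by rewrite subrr.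
    apply: (defect0B hmu rho1) => //; exact: L2fun_cindic.
  + move=> F ndF HF; split; first by apply: bigcupT_measurable => n; case: (HF n).
    by apply: defect_bigcup => // n; case: (HF n).
- move=> _ [a ->]; split; first exact: measurable_itv.
  exact: (defect_half hmu rho1 rhoN1).
- have e : @measurable _ (measurableTypeR R) = <<s @RGenInftyO.G R>>.
    exact: RGenInftyO.measurableE.
  by rewrite -e.
Qed.

Let defect0_sum (F : nat -> R -> R[i]) N :
  (forall i, L2 (F i)) -> (forall i, defect (F i) = 0) ->
  L2 (fun x => \sum_(i < N) F i x) /\ defect (fun x => \sum_(i < N) F i x) = 0.
Proof.
move=> F2 F0; elim: N => [|N [IH2 IH0]].
  have -> : (fun x => \sum_(i < 0) F i x) = (fun x => 0 * F 0%N x).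
    by apply/funext => x; rewrite big_ord0 mul0r.
  split; first exact: L2funZ.
  exact: (defect0Z hmu rho1).
have -> : (fun x => \sum_(i < N.+1) F i x) = (fun x => \sum_(i < N) F i x + F N x).
  by apply/funext => x; rewrite big_ord_recr.
by split; [exact: L2funD|exact: (defect0D hmu rho1 IH2 (F2 N) IH0 (F0 N))].
Qed.

Import HBNNSimple.

Let defect_nnsfun (g : {nnsfun (measurableTypeR R) >-> R}) :
  L2 (fun x => (g x)%:C) /\ defect (fun x => (g x)%:C) = 0.
Proof.
pose s : seq R := finmap.enum_fset (fset_set (g @` setT)).
pose F i : R -> R[i] := fun x => (s`_i)%:C * cindic (g @^-1` [set s`_i]) x.
have -> : (fun x => (g x)%:C) = (fun x => \sum_(i < size s) F i x).
  apply/funext => x; rewrite fimfunEord rmorph_sum; apply: eq_bigr => i _.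
  by rewrite rmorphM.
have mB i : measurable (g @^-1` [set s`_i]) by exact: measurable_sfunP.
apply: defect0_sum => i; first exact: (L2funZ _ (L2fun_cindic mu (mB i))).
exact: (defect0Z hmu rho1 _ (L2fun_cindic mu (mB i)) (defect_cindic (mB i))).
Qed.

Let defect_nonneg (f : R -> R) : measurable_fun setT f -> (forall x, 0 <= f x) ->
  rintegrable mu (fun x => f x ^+ 2) ->
  L2 (fun x => (f x)%:C) /\ defect (fun x => (f x)%:C) = 0.
Proof.
move=> mf f0 if2.
have f2 : L2 (fun x => (f x)%:C).
  apply: (L2fun_dominated _ if2); first exact: cmeasurable_real.
  by move=> x; rewrite normsq_real.
split => //.
have mEf : measurable_fun setT (EFin \o f : measurableTypeR R -> \bar R) by exact/measurable_EFinP.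
pose g := nnsfun_approx measurableT mEf.
have g2 n := (defect_nnsfun (g n)).1; have g0 n := (defect_nnsfun (g n)).2.
apply: (defect0_lim f2 g2 g0).
have gf x : g n x @[n --> \oo] --> f x.
  have := cvg_nnsfun_approx measurableT mEf (fun x _ => f0 x : (0%E <= (f x)%:E)%E) (I : setT x).
  by move=> /fine_cvg.
have gle n x : g n x <= f x.
  rewrite /g nnsfun_approxE -lee_fin; apply: le_approx => // y _.
  by rewrite lee_fin.
have mdiff n : measurable_fun setT (fun x => (f x - g n x) ^+ 2).
  apply: measurable_funX; apply: measurable_funB => //.
  exact: (L2fun_cmeasurable (g2 n)).1.
pose F n (x : measurableTypeR R) : \bar R := ((f x - g n x) ^+ 2)%:E.
have mF n : measurable_fun setT (F n) by apply/measurable_EFinP; exact: mdiff.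
have cF : {ae mu, forall x, setT x -> F ^~ x @ \oo --> (0%:E : \bar R)}.
  apply: aeW => x _; apply: cvg_EFin; first exact: nearW.
  have : (f x - g n x) ^+ 2 @[n --> \oo] --> (f x - f x) ^+ 2.
    have c : f x - g n x @[n --> \oo] --> f x - f x.
      by apply: cvgB; [exact: cvg_cst|exact: gf].
    by rewrite expr2; under eq_fun do rewrite expr2; exact: cvgM.
  by rewrite subrr expr0n.
have bF : {ae mu, forall x n, setT x -> (`|F n x| <= (f x ^+ 2)%:E)%E}.
  apply: aeW => x n _; rewrite /F /= lee_fin ger0_norm ?sqr_ge0 //.
  have g_ge0 : 0 <= g n x by exact: fun_ge0.
  by rewrite ler_pXn2r ?nnegrE ?subr_ge0 // lerBlDr lerDl.
have [_ _] := dominated_convergence measurableT mF (measurable_cst _) cF if2 bF.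
rewrite integral0 => /fine_cvg.
apply: cvg_trans; apply: near_eq_cvg; apply: nearW => n.
by apply: eq_Rintegral => x _; rewrite -rmorphB normsq_real.
Qed.

(** Split [v] into the positive and negative parts of its real and imaginary
parts. *)
Lemma defect_eq0 v : L2 v -> defect v = 0.
Proof.
move=> v2; have [mRe mIm] := L2fun_cmeasurable v2.
pose pos (h : R -> R) x := Num.max (h x) 0.
have posP (h : R -> R) : measurable_fun setT h ->
    (forall x, h x ^+ 2 <= normsq (v x)) ->
    L2 (fun x => (pos h x)%:C) /\ defect (fun x => (pos h x)%:C) = 0.
  move=> mh hv; apply: defect_nonneg.
  - by apply: measurable_maxr => //; exact: measurable_cst.
  - by move=> x; rewrite le_max lexx orbT.
  - apply: (rintegrable_le _ (normsq_integrable v2)) => [|x].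
      by apply: measurable_funX; apply: measurable_maxr => //; exact: measurable_cst.
    rewrite ger0_norm ?sqr_ge0 // (le_trans _ (hv x)) // /pos.
    by case: (leP (h x) 0) => // _; rewrite expr0n sqr_ge0.
have partP (h : R -> R) : measurable_fun setT h ->
    (forall x, h x ^+ 2 <= normsq (v x)) ->
    L2 (fun x => (h x)%:C) /\ defect (fun x => (h x)%:C) = 0.
  move=> mh hv; have [p2 p0] := posP h mh hv.
  have [n2 n0] : L2 (fun x => (pos (fun y => - h y) x)%:C) /\
      defect (fun x => (pos (fun y => - h y) x)%:C) = 0.
    by apply: posP => [|x]; [exact: measurable_funN|rewrite sqrrN].
  have -> : (fun x => (h x)%:C) = (fun x => (pos h x)%:C - (pos (fun y => - h y) x)%:C).
    apply/funext => x; rewrite -rmorphB; congr (_%:C); rewrite /pos.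
    exact: maxB_opp.
  split; [exact: L2funB|exact: (defect0B hmu rho1)].
have [re2 re0] : L2 (fun x => (complex.Re (v x))%:C) /\
    defect (fun x => (complex.Re (v x))%:C) = 0.
  by apply: partP => // x; rewrite lerDl sqr_ge0.
have [im2 im0] : L2 (fun x => (complex.Im (v x))%:C) /\
    defect (fun x => (complex.Im (v x))%:C) = 0.
  by apply: partP => // x; rewrite lerDr sqr_ge0.
have -> : v = (fun x => (complex.Re (v x))%:C + (0 +i* 1) * (complex.Im (v x))%:C).
  apply/funext => x; case: (v x) => a b; apply/eqP; rewrite eq_complex /=.
  by apply/andP; split; apply/eqP; ring.
apply: (defect0D hmu rho1 re2 (L2funZ _ im2) re0).
exact: (defect0Z hmu rho1).
Qed.

(** All terms are nonnegative, so it is enough to know the partial sums up to the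
powers of [4]. *)
Lemma sum_normsq_frame v : L2 v ->
  (\sum_(0 <= n <oo) (normsq (L2ip mu v (frame rho n)))%:E = (L2norm2 mu v)%:E)%E.
Proof.
move=> v2; pose a n := normsq (L2ip mu v (frame rho n)).
have a0 n : 0 <= a n by exact: normsq_ge0.
have coefsumE k : (coefsum mu rho k v)%:E = (\sum_(0 <= n < 4 ^ k) (a n)%:E)%E.
  by rewrite sumEFin big_mkord.
have cR : coefsum mu rho k v @[k --> \oo] --> L2norm2 mu v.
  rewrite -[X in _ --> X]subr0 -(defect_eq0 v2).
  have -> : (fun k => coefsum mu rho k v) =
      (fun k => L2norm2 mu v - partial_defect mu rho k v).
    by apply/funext => k; rewrite /partial_defect subKr.
  by apply: cvgB; [exact: cvg_cst|exact: cvg_defect].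
have cv : (coefsum mu rho k v)%:E @[k --> \oo] --> (L2norm2 mu v)%:E.
  by apply: cvg_EFin; [exact: nearW|exact: cR].
apply/eqP; rewrite eq_le; apply/andP; split.
  have icv : cvgn (fun n => \sum_(0 <= i < n) (a i)%:E)%E.
    by apply: (is_cvg_nneseries (P := xpredT)) => n _ _; rewrite lee_fin.
  apply: (lime_le icv); apply: nearW => n; apply: (@le_trans _ _ (coefsum mu rho n v)%:E).
    rewrite coefsumE; apply: lee_sum_nneg_natr => [k _ _|]; first by rewrite lee_fin.
    by rewrite ltnW // ltn_expl.
  by rewrite lee_fin coefsum_le.
apply: (cvge_to_le cv); apply: nearW => k; rewrite coefsumE.
by apply: nneseries_lim_ge => n _; rewrite lee_fin.
Qed.

End Density.

Theorem theorem2 (R : realType) (mu : probability (measurableTypeR R) R)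
    (hmu : is_mu4 mu) (rho : R[i]) (hrho : `|rho| = 1) (hrho1 : rho != -1) :
  parseval_frame mu (fun (n : nat) (x : R) =>
    ((1 + rho) / 2) ^+ count_digit4 1 n * 0 ^+ count_digit4 2 n *
    ((1 - rho) / 2) ^+ count_digit4 3 n * expi (2 * pi * n%:R * x)).
Proof.
split=> [n|v v2]; first exact: (L2fun_frame mu rho n).
rewrite (Lnorm_L2norm2 v2) -(sum_normsq_frame hmu hrho hrho1 v2).
by apply: eq_eseriesr => n _; rewrite sqr_normc_normsq.
Qed.
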